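(* Let $S=(b_1^{(m_1)},b_2^{(m_2)},\ldots,b_l^{(m_l)})$ be a tree eccentric sequence with $m_1+m_2+\cdots+m_l>2$. Then the caterpillar $\mathbb{T}(m_l-2,m_{l-1}-2,\ldots,m_2-2)$ minimises the Wiener index among all trees whose eccentric sequence is $S$, and it also maximises the number of subtrees among all trees whose eccentric sequence is $S$. In each of the two cases, $\mathbb{T}(m_l-2,m_{l-1}-2,\ldots,m_2-2)$ is the unique tree (up to isomorphism) with eccentric sequence $S$ having this property.
   Context: All graphs are finite and simple. In a connected graph $G$, $d_G(u,v)$ is the length of a shortest $u$-$v$ path, and the eccentricity of a vertex $u$ is $\mathrm{ecc}_G(u)=\max_{v\in V(G)}d_G(u,v)$. The eccentric sequence of $G$ is the nondecreasing sequence of the eccentricities of all vertices of $G$. It is written $(b_1^{(m_1)},\ldots,b_l^{(m_l)})$, meaning that $G$ has precisely $l$ distinct eccentricities $b_1<b_2<\cdots<b_l$ and that exactly $m_i\ge 1$ vertices have eccentricity $b_i$ (so $|V(G)|=m_1+\cdots+m_l$ and $b_l$ is the diameter). A sequence is a tree eccentric sequence if it is the eccentric sequence of some tree. The Wiener index of $G$ is $W(G)=\sum_{\{u,v\}\subseteq V(G)}d_G(u,v)$, the sum over all unordered pairs of vertices. The number of subtrees of a tree $T$ is the number of its (nonempty) connected subgraphs; single vertices count as subtrees. A pendant vertex is a vertex of degree $1$. A caterpillar is a tree such that removing all pendant vertices produces a path. Given an integer $q>0$, let $r=q/2$ if $q$ is even and $r=(q+1)/2$ if $q$ is odd. For nonnegative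 integers $t_1,\ldots,t_r$, $\mathbb{T}(t_1,\ldots,t_r)$ is the caterpillar constructed from the path $v_0,v_1,\ldots,v_{q+1}$ by attaching $t_j$ new pendant vertices at $v_j$ for all $1\le j\le r$. In the notation $\mathbb{T}(m_l-2,m_{l-1}-2,\ldots,m_2-2)$ associated with $S$, the integer $q$ is $q=b_l-1$ (so the path $v_0,\ldots,v_{q+1}$ has length $b_l$), $r=l-1$, and $t_j=m_{l+1-j}-2$ for $1\le j\le l-1$. *)

(* Defs.v *)
From HB Require Import structures.
From mathcomp Require Import all_boot.

Set Implicit Arguments.
Unset Strict Implicit.
Unset Printing Implicit Defensive.

Record sgraph := SGraph {
  vertex :> finType;
  adj : rel vertex;
  adj_sym : symmetric adj;
  adj_irrefl : irreflexive adj }.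

Definition isomorphic (G H : sgraph) : Prop :=
  exists2 f : G -> H, bijective f & {mono f : x y / adj x y}.

Definition connected (G : sgraph) : Prop :=
  0 < #|G| /\ forall x y : G, connect (@adj G) x y.

(* [ucycleb] also accepts a closed walk x, y, x along a single edge, hence the
   requirement of at least three vertices. *)
Definition acyclic (G : sgraph) : Prop :=
  forall c : seq G, 2 < size c -> ~~ ucycleb (@adj G) c.

Definition is_tree (G : sgraph) : Prop := connected G /\ acyclic G.

Definition path_of_length (G : sgraph) (x y : G) (n : nat) : bool :=
  [exists p : n.-tuple G,
    [&& path (@adj G) x p, uniq (x :: p) & last x p == y]].

(* A path has at most #|G| - 1 edges; the value is the junk #|G| when x and y
   are not connected. *)
Definition dist (G : sgraph) (x y : G) : nat :=
  find (path_of_length x y) (iota 0 #|G|).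

Definition ecc (G : sgraph) (x : G) : nat := \max_(y : G) dist x y.

Definition ecc_seq (G : sgraph) : seq nat :=
  sort leq [seq ecc x | x <- enum G].

(* The sequence (b_1^(m_1), ..., b_l^(m_l)); only the values of b and m at the
   indices 1, ..., l matter. *)
Definition mult_seq (l : nat) (b m : nat -> nat) : seq nat :=
  flatten [seq nseq (m i) (b i) | i <- iota 1 l].

Definition mult_form (l : nat) (b m : nat -> nat) : Prop :=
  (forall i j, 1 <= i -> i < j -> j <= l -> b i < b j) /\
  (forall i, 1 <= i <= l -> 1 <= m i).

Definition tree_with (s : seq nat) (G : sgraph) : Prop :=
  is_tree G /\ ecc_seq G = s.

(* Comparing ranks selects each pair of distinct vertices exactly once. *)
Definition wiener (G : sgraph) : nat :=
  \sum_(p : G * G | enum_rank p.1 < enum_rank p.2) dist p.1 p.2.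

Definition edges (G : sgraph) : {set {set G}} :=
  [set [set p.1; p.2] | p : G * G & adj p.1 p.2].

(* A subgraph is a pair of a set of vertices and a set of edges of G whose
   endpoints are among these vertices. *)
Definition connected_subgraph (G : sgraph) (H : {set G} * {set {set G}}) : bool :=
  [&& H.1 != set0, H.2 \subset edges G,
      [forall e in H.2, e \subset H.1] &
      [forall x in H.1, forall y in H.1,
        connect (fun u v => [set u; v] \in H.2) x y]].

Definition num_subtrees (G : sgraph) : nat :=
  #|[set H : {set G} * {set {set G}} | connected_subgraph H]|.

Definition minimises (f : sgraph -> nat) (P : sgraph -> Prop) (G : sgraph) : Prop :=
  P G /\ forall H, P H -> f G <= f H.

Definition maximises (f : sgraph -> nat) (P : sgraph -> Prop) (G : sgraph) : Prop :=
  P G /\ forall H, P H -> f H <= f G.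

(* T(t_1, ..., t_r) on the path v_0, ..., v_{q+1}, with r = uphalf q.  The vertex
   [inl i] is v_i; the elements of [inr] whose tag is j are the t_{j+1} pendant
   vertices attached at v_{j+1}, since the ordinals j < r start at 0. *)
Section Caterpillar.
Variables (q : nat) (t : nat -> nat).

Definition cat_vertex : finType :=
  ('I_q.+2 + {j : 'I_(uphalf q) & 'I_(t j.+1)})%type.

Definition cat_adj (x y : cat_vertex) : bool :=
  match x, y with
  | inl i, inl k => (k == i.+1 :> nat) || (i == k.+1 :> nat)
  | inl i, inr p | inr p, inl i => i == (tag p).+1 :> nat
  | inr _, inr _ => false
  end.

Lemma cat_adj_sym : symmetric cat_adj.
Proof. by move=> [i|p] [k|p'] //=; rewrite orbC. Qed.

Lemma cat_adj_irrefl : irreflexive cat_adj.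
Proof. by move=> [i|p] //=; rewrite orbb ltn_eqF. Qed.

Definition caterpillar : sgraph := SGraph cat_adj_sym cat_adj_irrefl.

End Caterpillar.

(* t_j = m_{l+1-j} - 2 for 1 <= j <= l - 1. *)
Definition ecc_caterpillar (l : nat) (b m : nat -> nat) : sgraph :=
  caterpillar (b l - 1) (fun j => m (l + 1 - j) - 2).

(* Main.v *)
(** The eccentricities of a tree are its levels around the centre, so a tree
    eccentric sequence prescribes the level sizes, together with two vertices of
    maximal level on different sides of the centre.  Cut an edge at the centre and
    hang each side from its end.  If [s v] is the number of descendants of [v] and
    [f v] the number of subtrees with highest vertex [v], then [s v] is one plus the
    sum, and [f v] the product of the [f w + 1], over the children [w].  Hence on a
    level the sum of the [s v], and the product of the [f v], are governed by the
    level below, while two vertices of the level have [s] and [f] at least [y], the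
    number of levels from there to the lowest one.  The Wiener index is a sum of
    [s v * (n - s v)], the number of subtrees essentially a sum of the [f v]; by
    convexity both are extremal, level by level, when all vertices but two are
    leaves and one of these two has the least possible value [y].  This forces all
    pendant vertices onto one half of a path. *)
Require Import Defs.
From HB Require Import structures.
From mathcomp Require Import all_boot zify.

Set Implicit Arguments.
Unset Strict Implicit.
Unset Printing Implicit Defensive.

(** * Distances *)

(** The two halves differ in what a level inherits from below. Level sizes determine the sum of the
    [s v] on each level, so for the Wiener index the levels are independent: a fixed sum is
    distributed so that the sum of squares is largest. They do not determine the product of the
    [f v]; this is only bounded, and the bound on level k comes from one for the product of the
    [f v + 1] on level k + 1. So the estimate on a level has to turn one bound on a product into
    two, for the sum and for the shifted product. The cut edge is accounted for apart. For odd
    diameter its two ends share level 1, and the edge shows up twice in the Wiener sum. The subtrees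
    through the centre (for odd diameter, through the cut edge) give one more product over level 1.
    For uniqueness, an extremal tree is shown to have two spines to which everything is attached in
    a prescribed way. Adjacency then depends only on labels whose frequencies are determined by the
    level sizes. *)

Section Distance.
Variable G : sgraph.
Implicit Types x y z : G.

Lemma adj_neq x y : adj x y -> x != y.
Proof. by move=> xy; apply: contraTneq xy => ->; rewrite adj_irrefl. Qed.

Lemma path_of_lengthP x y n :
  reflect (exists p, [/\ path (@adj G) x p, uniq (x :: p), last x p = y
                       & size p = n])
          (path_of_length x y n).
Proof.
apply: (iffP existsP) => [[p /and3P[xp up /eqP lp]]|[p [xp up lp sp]]].
  by exists p; rewrite size_tuple.
by exists (tcast sp (in_tuple p)); rewrite val_tcast xp up lp /=.
Qed.

(** [dist] searches only simple paths with fewer than [#|G|] edges. The given walk is shortened to a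
    simple path, which lies in that range. *)
Lemma dist_le x y p :
  path (@adj G) x p -> last x p = y -> dist x y <= size p.
Proof.
move=> xp lp; case: (shortenP xp) lp => q xq uq sub lq.
have lt_q : size q < #|G| by move: (card_uniqP uq) (max_card (mem (x :: q))) => /= ->.
have le_q : size q <= size p by apply: uniq_leq_size sub; case/andP: uq.
apply: leq_trans le_q; rewrite leqNgt; apply/negP => /(before_find 0).
rewrite nth_iota // add0n => /negbT/negP; apply; apply/path_of_lengthP; by exists q.
Qed.

Lemma dist_path x y : connect (@adj G) x y ->
  exists p, [/\ path (@adj G) x p, uniq (x :: p), last x p = y
              & size p = dist x y].
Proof.
case/connectP => p0 xp0 ->; have := shortenP xp0 => -[q xq uq _].
have lt_q : size q < #|G| by move: (card_uniqP uq) (max_card (mem (x :: q))) => /= ->.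
have has_q : has (path_of_length x (last x q)) (iota 0 #|G|).
  apply/hasP; exists (size q); first by rewrite mem_iota.
  by apply/path_of_lengthP; exists q.
have := nth_find 0 has_q; rewrite -/(dist _ _) nth_iota ?add0n; last first.
  by rewrite has_find size_iota in has_q.
by case/path_of_lengthP => p [? ? ? ?]; exists p.
Qed.

Lemma dist_refl x : dist x x = 0.
Proof. by apply/eqP; rewrite -leqn0; apply: (@dist_le x x [::]). Qed.

Lemma dist_adj_le (c x y : G) : connect (@adj G) c x -> adj x y ->
  dist c y <= (dist c x).+1.
Proof.
case/dist_path => p [cp _ lp <-] xy; rewrite -(size_rcons p y).
by apply: dist_le; rewrite ?last_rcons // rcons_path cp lp.
Qed.

Lemma dist_prev (c x : G) : connect (@adj G) c x -> x != c ->
  exists2 z, adj x z & dist c x = (dist c z).+1.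
Proof.
move=> cx xc; have [p [cp _ lp sp]] := dist_path cx.
case/lastP: p cp lp sp => [|p y]; first by move=> _ /= cE; rewrite cE eqxx in xc.
rewrite rcons_path last_rcons size_rcons => /andP[cp zy] yE; subst y => sp.
exists (last c p); first by rewrite adj_sym.
apply/eqP; rewrite eqn_leq dist_adj_le // ?andbT -?sp ?ltnS; last first.
  by apply/connectP; exists p.
by rewrite dist_le.
Qed.

End Distance.

(** * Uniqueness of the neighbour closer to a given vertex *)

Section TreeParent.
Variable (G : sgraph).
Hypothesis tG : is_tree G.
Variable c : G.

Let conG x y : connect (@adj G) x y.
Proof. by case: tG => -[]. Qed.

(** A shortest path from [c] to [y] cannot meet [x]: its part up to [x] would be shorter than the
    distance of [x] from [c]. *)
Lemma connect_avoiding (x y : G) : x != y -> dist c y <= dist c x ->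
  x != c ->
  connect (fun u v => [&& adj u v, u != x & v != x]) c y.
Proof.
move=> xy yx xc; have [p [cp up lp sp]] := dist_path (conG c y).
have xp : x \notin p.
  apply/negP => /splitPr xp; case: xp cp lp sp => p1 p2.
  rewrite cat_path /= => /and3P[cp1 l1x _]; rewrite last_cat /=.
  case: p2 => [|z p2] /=; first by move/eqP: xy.
  move=> _; rewrite size_cat /=.
  have := @dist_le G c x (rcons p1 x); rewrite rcons_path last_rcons size_rcons cp1 l1x.
  by move=> /(_ isT erefl); lia.
apply/connectP; exists p; rewrite ?lp //.
elim: p (c) xc xp cp {up lp sp} => //= z p IHp u xu.
rewrite inE negb_or => /andP[xz xp] /andP[-> zp] /=.
by rewrite eq_sym xu eq_sym xz IHp // eq_sym.
Qed.

(** Two such neighbours would be joined through [c] by a path avoiding [x], which [x] closes to a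
    cycle. As the inequalities are weak, this also rules out edges between vertices at equal
    distance from [c]. *)
Lemma tree_closer_neighbour_uniq (x y z : G) : adj x y -> adj x z ->
  dist c y <= dist c x -> dist c z <= dist c x -> y = z.
Proof.
move=> xy xz yx zx; apply/eqP/negPn/negP => yz.
have xc : x != c.
  apply/eqP => xE; move: yx zx; rewrite xE dist_refl !leqn0 => /eqP y0 _.
  have [p [_ _ lp]] := dist_path (conG c y); rewrite y0 => /size0nil pE.
  by move: lp xy; rewrite pE xE /= => ->; rewrite adj_irrefl.
set r := fun u v : G => [&& adj u v, u != x & v != x].
have r_sym : symmetric r by move=> u v; rewrite /r adj_sym; congr (_ && _); rewrite andbC.
have yz_con : connect r y z.
  apply: (connect_trans (y := c)); last exact: connect_avoiding (adj_neq xz) zx xc.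
  by rewrite (sym_connect_sym r_sym); exact: connect_avoiding (adj_neq xy) yx xc.
case/connectP: yz_con => p0 yp0 zE; case: (shortenP yp0) zE => p yp up _ lp.
have pN : p != [::] by apply: contraNneq yz => pE; rewrite lp pE.
have xN : x \notin y :: p.
  elim: p (y) xy yp {up lp pN yz yx} => [|w p IHp] u xu /=.
    by rewrite inE adj_neq.
  case/andP => /and3P[_ ux wx] wp; rewrite inE negb_or eq_sym ux /=.
  clear IHp; elim: p w wx wp => [|v p IHp] w wx /=; first by rewrite inE eq_sym.
  by case/andP => /and3P[_ _ vx] vp; rewrite inE negb_or eq_sym wx IHp.
have ap : path (@adj G) y p by apply: sub_path yp => u v /and3P[].
case: tG => _ /(_ (x :: y :: p)) /=; case: (p) pN lp up xN ap => // w q _ lp up xN ap.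
move/(_ isT)/negP; apply; apply/andP; split; last by rewrite cons_uniq xN.
by rewrite (cycle_path x) /= -[last w q]/(last y (w :: q)) -lp adj_sym xz xy.
Qed.
End TreeParent.

(** * Rooted trees *)

(** Parent and depth are abstract data: an arbitrary tree gets them from distances, the caterpillar
    from explicit formulas. With [par c = c], iterated parents stay at the root. *)
Record rooted (G : sgraph) (c : G) (par : G -> G) (dp : G -> nat) : Prop :=
  Rooted {
    par_root : par c = c;
    dp_root : dp c = 0;
    dp_par : forall x, x != c -> dp x = (dp (par x)).+1;
    adj_par : forall x y,
      adj x y = (x != y) && ((par x == y) || (par y == x)) }.

(** The second argument is the lower one: iterated parents lead from [x] up to [v], possibly in no
    step. *)
Definition below (T : finType) (par : T -> T) (v x : T) := fconnect par x v.

Lemma belowE (T : finType) (par : T -> T) (v x : T) :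
  below par v x = (x == v) || below par v (par x).
Proof.
apply/idP/orP => [|[/eqP->|]]; first 1 last.
- exact: connect0.
- exact: connect_trans (fconnect1 _ _).
move/iter_findex <-; case: (findex _ _ _) => [|n]; first by left.
by right; rewrite iterSr; apply: fconnect_iter.
Qed.

Section Rooted.
Variables (G : sgraph) (c : G) (par : G -> G) (dp : G -> nat).
Hypothesis RG : rooted c par dp.
Implicit Types x y u v w : G.
Local Notation below := (below par).

Lemma dp_par_le x : dp (par x) = (dp x).-1.
Proof.
case: (eqVneq x c) => [->|xc]; last by rewrite (dp_par RG xc).
by rewrite (par_root RG) (dp_root RG).
Qed.

Lemma dp_iter_par k x : dp (iter k par x) = dp x - k.
Proof. by elim: k => [|k IHk] /=; rewrite ?subn0 // dp_par_le IHk; lia. Qed.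

Lemma dp_eq0 x : (dp x == 0) = (x == c).
Proof.
by case: (eqVneq x c) => [->|xc]; [rewrite (dp_root RG)|rewrite (dp_par RG xc)].
Qed.

Lemma dp_gt0 x : (0 < dp x) = (x != c).
Proof. by rewrite lt0n dp_eq0. Qed.

Lemma par_neq x : x != c -> par x != x.
Proof. by move=> xc; apply/eqP => px; have := dp_par RG xc; rewrite px; lia. Qed.

Lemma adj_par_self x : x != c -> adj x (par x).
Proof. by move=> xc; rewrite (adj_par RG) eqxx andbT eq_sym par_neq. Qed.

Lemma below_refl x : below x x.
Proof. exact: connect0. Qed.

Lemma below_par v x : below v (par x) -> below v x.
Proof. by rewrite [below v x]belowE => ->; rewrite orbT. Qed.

(** Each step up lowers the depth by one until the root is reached, so the depths tell how many
    steps lead from [x] to [v]. *)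
Lemma below_dp v x : below v x -> v = iter (dp x - dp v) par x.
Proof.
move=> vx; have := iter_findex vx; set k := findex _ _ _ => kE.
have dv : dp v = dp x - k by rewrite -kE dp_iter_par.
case: (leqP k (dp x)) => kx; first by rewrite dv subKn.
have v0 : v = c by apply/eqP; rewrite -dp_eq0 dv; lia.
rewrite v0 (dp_root RG) subn0; apply/esym/eqP.
by rewrite -dp_eq0 dp_iter_par subnn.
Qed.

Lemma below_dp_le v x : below v x -> dp v <= dp x.
Proof. by move/below_dp => ->; rewrite dp_iter_par leq_subr. Qed.

Lemma below_dp_eq v x : below v x -> dp x <= dp v -> v = x.
Proof. by move/below_dp => vE; rewrite -subn_eq0 => /eqP d0; rewrite vE d0. Qed.

Lemma below_trans u v x : below u v -> below v x -> below u x.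
Proof. by move=> uv vx; apply: connect_trans uv. Qed.

Lemma below_root x : below c x.
Proof.
have <- : iter (dp x) par x = c by apply/eqP; rewrite -dp_eq0 dp_iter_par subnn.
exact: fconnect_iter.
Qed.

Lemma below_total u v x : below u x -> below v x -> dp u <= dp v -> below u v.
Proof.
move=> ux vx uv; rewrite (below_dp ux) (below_dp vx).
have -> : dp x - dp u = dp v - dp u + (dp x - dp v).
  by have := below_dp_le ux; have := below_dp_le vx; lia.
by rewrite iterD; apply: fconnect_iter.
Qed.

Lemma below_par_strict v x : x != v -> below v x = below v (par x).
Proof. by rewrite [below v x]belowE => /negPf->. Qed.

(* The edge from [v] to its parent separates [x] from [y] exactly when one of
   the two lies below [v]; so this is the distance. *)
Definition sep x y := \sum_(v | v != c) (below v x != below v y).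

Lemma sepC x y : sep x y = sep y x.
Proof. by apply: eq_bigr => v _; rewrite eq_sym. Qed.

Lemma sep_refl x : sep x x = 0.
Proof. by apply: big1 => v _; rewrite eqxx. Qed.

Lemma sep_tri x y z : sep x z <= sep x y + sep y z.
Proof.
rewrite -big_split; apply: leq_sum => v _ /=.
by case: (below v x); case: (below v y); case: (below v z).
Qed.

(** As [y] is not deeper than [x], it does not lie below [x]. So the edge above [x] separates the
    two, and it is the only edge crossed by the step to [par x]. *)
Lemma sep_par x y : x != y -> dp y <= dp x -> sep x y = (sep (par x) y).+1.
Proof.
move=> xy yx; have xc : x != c.
  by apply: contraNneq xy => xc; rewrite xc eq_sym -dp_eq0 -leqn0 -(dp_root RG) -xc.
rewrite /sep (bigD1 x) //= [in RHS](bigD1 x) //= below_refl.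
have -> : below x y = false.
  by apply/negP => /below_dp_eq /(_ yx) xE; rewrite xE eqxx in xy.
have -> : below x (par x) = false.
  by apply/negP => /below_dp_le; rewrite (dp_par RG xc) ltnn.
rewrite add0n add1n; congr _.+1; apply: eq_bigr => v /andP[_ vx].
by rewrite below_par_strict // eq_sym.
Qed.

Lemma sep_adj x y : adj x y -> sep x y <= 1.
Proof.
rewrite (adj_par RG); case/andP => xy.
wlog /eqP px : x y xy / par x == y.
  by move=> H /orP[h|h]; [|rewrite sepC]; apply: H; rewrite ?h // eq_sym.
move=> _; have [xc|xc] := eqVneq x c.
  by rewrite xc (par_root RG) -xc in px; rewrite px eqxx in xy.
by rewrite sep_par // -px ?sep_refl // dp_par_le leq_pred.
Qed.

Lemma sep_le_path x p : path (@adj G) x p -> sep x (last x p) <= size p.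
Proof.
elim: p x => [|y p IHp] x /=; first by rewrite sep_refl.
by case/andP => /sep_adj xy /IHp; have := sep_tri x y (last y p); lia.
Qed.

(** The walk climbs from whichever end is deeper, by induction on the sum of the depths. *)
Lemma sep_path x y :
  exists p, [/\ path (@adj G) x p, last x p = y & size p = sep x y].
Proof.
move: {2}(_ + _) (leqnn (dp x + dp y)) => n; elim: n x y => [|n IHn] x y.
  move=> le0; have : dp x == 0 by lia. have : dp y == 0 by lia.
  by rewrite !dp_eq0 => /eqP-> /eqP->; exists [::]; rewrite sep_refl; split.
move=> le_n; have [->|xy] := eqVneq x y; first by exists [::]; rewrite sep_refl; split.
case/orP: (leq_total (dp y) (dp x)) => le_xy.
  have xc : x != c.
    apply: contraNneq xy => xc; rewrite xc eq_sym -dp_eq0 -leqn0.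
    by rewrite -(dp_root RG) -xc.
  have [|p [xp lp sp]] := IHn (par x) y.
    by have := dp_par RG xc; lia.
  exists (par x :: p); split => //=; first by rewrite adj_par_self.
  by rewrite sp (sep_par xy).
have yc : y != c.
  apply: contraNneq xy => yc; rewrite yc -dp_eq0 -leqn0.
  by rewrite -(dp_root RG) -yc.
have [|p [xp lp sp]] := IHn x (par y).
  by have := dp_par RG yc; lia.
exists (rcons p y); rewrite rcons_path last_rcons size_rcons xp lp sp adj_sym.
split=> //; first by rewrite adj_par_self.
by rewrite sepC [RHS]sepC (@sep_par y x) // eq_sym.
Qed.

Lemma rooted_connect x y : connect (@adj G) x y.
Proof. by have [p [xp lp _]] := sep_path x y; apply/connectP; exists p. Qed.

Lemma dist_sep x y : dist x y = sep x y.
Proof.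
apply/eqP; rewrite eqn_leq; apply/andP; split.
  by have [p [xp lp <-]] := sep_path x y; apply: dist_le.
have [p [xp _ <- <-]] := dist_path (rooted_connect x y).
exact: sep_le_path.
Qed.

(** A deepest vertex of a cycle would have both its neighbours on the cycle equal to its parent. *)
Lemma rooted_is_tree : is_tree G.
Proof.
split; first by split; [apply/card_gt0P; exists c|apply: rooted_connect].
move=> s s2; apply/negP => /andP[cs us].
have [x xs xmax] : exists2 x, x \in s & forall y, y \in s -> dp y <= dp x.
  case: s s2 {cs us} => // x0 s _.
  case: (arg_maxnP (P := mem (x0 :: s)) dp (mem_head x0 s)) => x xs xm.
  by exists x.
have par_max y : y \in s -> adj x y -> y = par x.
  move=> /xmax yx; rewrite (adj_par RG) => /andP[xy /orP[/eqP->//|/eqP py]].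
  have [yc|yc] := eqVneq y c.
    by move: xy; rewrite -py yc (par_root RG) eqxx.
  by move: yx; rewrite (dp_par RG yc) py ltnn.
case/rot_to: xs => i [|y p] sE; first by move: s2; rewrite -(size_rot i) sE.
have mem_s z : z \in y :: p -> z \in s.
  by move=> zp; rewrite -(mem_rot i) sE inE zp orbT.
case: p => [|z p] in sE mem_s *; first by move: s2; rewrite -(size_rot i) sE.
move: cs us; rewrite -(rot_cycle i) -(rot_uniq i) sE (cycle_path x) /=.
case/andP => lx /andP[xy _] /and3P[_ yN _].
have yE := par_max y (mem_s y (mem_head _ _)) xy.
have lE : last z p = par x.
  apply: par_max; last by rewrite adj_sym.
  by apply: mem_s; rewrite inE mem_last orbT.
by move: yN; rewrite yE -lE mem_last.
Qed.

Lemma dp_sum x : dp x = \sum_(v | v != c) below v x.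
Proof.
have <- : sep x c = dp x.
  move: {2}(dp x) (erefl (dp x)) => n; elim: n x => [|n IHn] x dx.
    by move/eqP: dx; rewrite dp_eq0 => /eqP->; rewrite sep_refl (dp_root RG).
  have xc : x != c by rewrite -dp_gt0 dx.
  by rewrite sep_par ?(dp_root RG) // IHn dp_par_le dx.
apply: eq_bigr => v vc; case: (boolP (below v c)) => [/below_dp_le|_].
  by rewrite (dp_root RG) leqNgt dp_gt0 vc.
by case: (below v x).
Qed.

(** An edge above both [x] and [y] is counted in both depths but does not separate them. *)
Lemma dist_common x y :
  dist x y + 2 * \sum_(v | v != c) (below v x && below v y) = dp x + dp y.
Proof.
rewrite dist_sep !dp_sum big_distrr -!big_split; apply: eq_bigr => v _ /=.
by case: (below v x); case: (below v y).
Qed.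

Lemma dist_dp_le x y : dist x y <= dp x + dp y.
Proof. by rewrite -dist_common leq_addr. Qed.

Lemma dist_common_le b x y : b != c -> below b x -> below b y ->
  dist x y + 2 <= dp x + dp y.
Proof.
move=> bc bx b_y; rewrite -dist_common leq_add2l (bigD1 b) //= bx b_y /=.
by rewrite mulnDr leq_addr.
Qed.

(** The shortest path runs through the root: a common ancestor other than [c] would lie below [b],
    and with it [y]. *)
Lemma dist_branch b x y : b != c -> par b = c -> below b x -> ~~ below b y ->
  dist x y = dp x + dp y.
Proof.
move=> bc pb bx b_y; rewrite -dist_common big1 ?addn0 // => v vc.
case: (boolP (below v x)) => //= vx; case: (boolP (below v y)) => //= vy.
case/negP: b_y; apply: below_trans vy; apply: below_total bx vx _.
by rewrite (dp_par RG bc) pb (dp_root RG) dp_gt0.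
Qed.

Lemma dist_below v x : below v x -> dist v x = dp x - dp v.
Proof.
move=> vx; have := dist_common v x.
have -> : \sum_(u | u != c) (below u v && below u x) = dp v.
  rewrite dp_sum; apply: eq_bigr => u _; case: (boolP (below u v)) => //= uv.
  by rewrite (below_trans uv vx).
by have := below_dp_le vx; lia.
Qed.

End Rooted.

(** * Rooting a tree at an arbitrary vertex *)

Section TreeRooted.
Variable (G : sgraph).
Hypothesis tG : is_tree G.

Lemma tree_rooted (c : G) :
  exists par, rooted c par (fun x => dist c x).
Proof.
have conG x y : connect (@adj G) x y by case: tG => -[].
(* The default [c] is never taken: by [dist_prev] every other vertex has a closer neighbour. *)
pose par x := if x == c then c else odflt c [pick y | adj x y & dist c y < dist c x].
have par_c : par c = c by rewrite /par eqxx.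
have parP x : x != c -> adj x (par x) /\ dist c x = (dist c (par x)).+1.
  move=> xc; rewrite /par (negPf xc); case: pickP => [y /andP[xy yx]|no] /=.
    split=> //; have := dist_adj_le (conG c y) (_ : adj y x).
    by rewrite adj_sym => /(_ xy); lia.
  have [z xz dz] := dist_prev (conG c x) xc.
  by have := no z; rewrite xz dz ltnSn.
have par_eq x y : adj x y -> dist c y <= dist c x -> par x = y.
  move=> xy yx; have [xc|xc] := eqVneq x c.
    move: yx; rewrite xc dist_refl leqn0 => /eqP y0.
    have [p [_ _ lp]] := dist_path (conG c y); rewrite y0 => /size0nil pE.
    by move: lp xy; rewrite pE xc /= => ->; rewrite adj_irrefl.
  have [xp dx] := parP x xc.
  by apply: (tree_closer_neighbour_uniq tG (c := c) xp xy) => //; rewrite dx.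
exists par; split=> //; first exact: dist_refl.
  by move=> x /parP[].
move=> x y; apply/idP/andP => [xy|[xy]].
  split; first exact: adj_neq.
  case/orP: (leq_total (dist c y) (dist c x)) => h.
    by rewrite (par_eq x y) ?eqxx.
  by rewrite (par_eq y x) ?eqxx ?orbT // adj_sym.
have main u v : u != v -> par u = v -> adj u v.
  move=> uv pu; have [uc|/parP[]] := eqVneq u c; last by rewrite pu.
  by move: uv; rewrite -pu uc par_c eqxx.
by case/orP=> /eqP /main; [|rewrite adj_sym]; apply; rewrite // eq_sym.
Qed.

End TreeRooted.

(** * Wiener index and subtrees of a rooted tree *)

Definition subtree_size (T : finType) (par : T -> T) (v : T) : nat :=
  #|[set x | below par v x]|.

(** The diagonal contributes nothing, and swapping the two entries matches the remaining ordered
    pairs. *)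
Lemma wiener_double (G : sgraph) :
  (forall x y : G, dist x y = dist y x) ->
  2 * wiener G = \sum_(x : G) \sum_(y : G) dist x y.
Proof.
move=> dC; rewrite pair_big /= mul2n -addnn /wiener.
rewrite [RHS](bigID (fun p : G * G => enum_rank p.1 < enum_rank p.2)) /=; congr (_ + _).
rewrite [RHS](bigID (fun p : G * G => p.1 == p.2)) /= [X in X + _]big1; last first.
  by move=> [x y] /= /andP[_ /eqP->]; rewrite dist_refl.
rewrite add0n (reindex (fun p : G * G => (p.2, p.1))) /=; last first.
  by exists (fun p => (p.2, p.1)) => -[].
apply: eq_big => [[x y]|[x y] _] //=.
by rewrite -leqNgt ltn_neqAle (inj_eq val_inj) (inj_eq enum_rank_inj) eq_sym andbC.
Qed.

Section Counting.
Variables (G : sgraph) (c : G) (par : G -> G) (dp : G -> nat).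
Hypothesis RG : rooted c par dp.
Implicit Types (x y u v w : G) (U : {set G}).
Local Notation below := (below par).
Local Notation size_at := (subtree_size par).

(** As an equation between numbers, this also says that the branches of the children of [v] are
    disjoint and miss [v]. Sums over a branch therefore split. *)
Lemma below_children v x :
  below v x = (x == v) + \sum_(w | (w != c) && (par w == v)) below w x :> nat.
Proof.
move: {2}(dp x) (erefl (dp x)) => n; elim: n x => [|n IHn] x dx.
  move/eqP: dx; rewrite (dp_eq0 RG) => /eqP->.
  rewrite big1 => [|w /andP[wc _]]; last first.
    case: (boolP (below w c)) => // /(below_dp_le RG).
    by rewrite (dp_root RG) leqNgt (dp_gt0 RG) wc.
  rewrite addn0 belowE (par_root RG).
  case: eqVneq => //= cv; case: (boolP (below v c)) => // /(below_dp_le RG).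
  by rewrite (dp_root RG) leqNgt (dp_gt0 RG) eq_sym cv.
have xc : x != c by rewrite -(dp_gt0 RG) dx.
have strict w : below w (par x) -> (x == w) = false.
  move/(below_dp_le RG) => h; apply: contraTF h => /eqP<-.
  by rewrite (dp_par RG xc) ltnn.
have split_eq w : below w x = (x == w) + below w (par x) :> nat.
  by rewrite belowE; case: (boolP (below w (par x))) => [/strict->|_] //; case: (x == w).
rewrite split_eq IHn; last by rewrite (dp_par_le RG) dx.
rewrite (eq_bigr _ (fun w _ => split_eq w)) big_split /=; congr (_ + (_ + _)).
rewrite -big_mkcondr /= (eq_bigl (fun w => (par x == v) && (w == x))); last first.
  by move=> w; case: (eqVneq x w) => [<-|_]; rewrite ?xc ?andbT ?andbF // eq_sym.
by case: eqP => _; [rewrite (big_pred1 x)|rewrite big_pred0].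
Qed.

Lemma subtree_size_sum v : size_at v = \sum_x below v x.
Proof. by rewrite /subtree_size -sum1dep_card big_mkcond. Qed.

Lemma subtree_sizeE v :
  size_at v = (\sum_(w | (w != c) && (par w == v)) size_at w).+1.
Proof.
rewrite subtree_size_sum (eq_bigr _ (fun x _ => below_children v x)) big_split /=.
rewrite exchange_big /= -add1n; congr (_ + _).
  by rewrite -big_mkcond /= big_pred1_eq.
by apply: eq_bigr => w _; rewrite subtree_size_sum.
Qed.

Lemma subtree_size_root : size_at c = #|G|.
Proof. by rewrite -cardsT; apply: eq_card => x; rewrite !inE (below_root RG). Qed.

Lemma subtree_size_le v : size_at v <= #|G|.
Proof. exact: max_card. Qed.

(** Counting by edges: the one above [v] separates the vertices below [v] from all others, and a
    distance is the number of separating edges. *)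
Lemma rooted_wiener :
  wiener G = \sum_(v | v != c) size_at v * (#|G| - size_at v).
Proof.
apply/eqP; rewrite -(eqn_pmul2l (isT : 0 < 2)) wiener_double; last first.
  by move=> x y; rewrite !(dist_sep RG) sepC.
under eq_bigr => x _ do under eq_bigr => y _ do rewrite (dist_sep RG).
rewrite (eq_bigr (fun x => \sum_(v | v != c) \sum_y (below v x != below v y)));
  last by move=> x _; apply: exchange_big.
rewrite exchange_big big_distrr /=; apply/eqP/eq_bigr => v _.
have nE : \sum_y ~~ below v y = #|G| - size_at v.
  apply/eqP; rewrite -(eqn_add2l (size_at v)) subnKC ?subtree_size_le //.
  rewrite subtree_size_sum -big_split -sum1_card; apply/eqP/eq_bigr => y _ /=.
  by case: below.
rewrite (eq_bigr (fun x => below v x * (#|G| - size_at v) + ~~ below v x * size_at v));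
  last first.
  move=> x _; case: (below v x) => /=.
    by rewrite mul1n addn0 -nE; apply: eq_bigr => y _; case: below.
  by rewrite mul1n mul0n subtree_size_sum; apply: eq_bigr => y _; case: below.
rewrite big_split /= -!big_distrl /= -subtree_size_sum.
by rewrite nE mulnC addnn mul2n.
Qed.

(* [U] induces a connected subgraph whose vertex closest to the root is [v]. *)
Definition topped v (U : {set G}) :=
  (v \in U) && [forall u in U, (u == v) || (u != c) && (par u \in U)].

Definition subtree_count v := #|[set U : {set G} | topped v U]|.

Lemma toppedP v U :
  reflect (v \in U /\ forall u, u \in U -> u != v -> u != c /\ par u \in U)
          (topped v U).
Proof.
apply: (iffP andP) => -[vU H]; split=> //.
  by move=> u uU uv; move/forall_inP/(_ u uU): H; rewrite (negPf uv) => /andP[].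
apply/forall_inP => u uU; case: eqVneq => //= uv.
by have [-> ->] := H u uU uv.
Qed.

Lemma topped_below v U u : topped v U -> u \in U -> below v u.
Proof.
case/toppedP => vU H; move: {2}(dp u) (erefl (dp u)) => n.
elim: n u => [|n IHn] u du uU; have [->|uv] := eqVneq u v; try exact: below_refl.
  by have [uc _] := H u uU uv; move/eqP: du; rewrite (dp_eq0 RG) (negPf uc).
have [uc pU] := H u uU uv.
by apply: below_par; apply: IHn; rewrite // (dp_par_le RG) du.
Qed.

Lemma topped_uniq v w U : topped v U -> topped w U -> v = w.
Proof.
move=> tv tw; have [vU _] := toppedP _ _ tv; have [wU _] := toppedP _ _ tw.
have vw := topped_below tv wU; have wv := topped_below tw vU.
exact: (below_dp_eq RG vw (below_dp_le RG wv)).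
Qed.

Definition induced (U : {set G}) : {set {set G}} :=
  [set e in edges G | e \subset U].

Lemma edges_adj x y : ([set x; y] \in edges G) = adj x y.
Proof.
apply/imsetP/idP => [[[u v]]|xy]; last by exists (x, y); rewrite ?inE.
rewrite inE /= => uv e.
have := set21 u v; rewrite -e !inE; have := set22 u v; rewrite -e !inE.
move=> /orP[]/eqP ? /orP[]/eqP ?; subst.
all: solve [by [] | by rewrite adj_sym | by move: uv; rewrite adj_irrefl].
Qed.

Lemma edgesP e : e \in edges G -> exists2 x, x != c & e = [set x; par x].
Proof.
case/imsetP => -[x y]; rewrite inE /= (adj_par RG) => /andP[xy].
case/orP => /eqP pE ->.
  exists x; rewrite ?pE //; apply: contraNneq xy => xc.
  by rewrite xc -pE xc (par_root RG).
exists y; rewrite ?pE 1?setUC //; apply: contraNneq xy => yc.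
by rewrite yc -pE yc (par_root RG).
Qed.

(* Only the edge from [u] to its parent leaves the set of vertices below [u]. *)
Lemma below_closed (F : {set {set G}}) u :
  F \subset edges G -> [set u; par u] \notin F ->
  forall x y, connect (fun a b => [set a; b] \in F) x y -> below u x = below u y.
Proof.
move=> FE uF x y /connectP[p xp ->]; elim: p x xp => //= z p IHp x /andP[xz zp].
rewrite -(IHp z zp) {IHp zp}.
have := subsetP FE _ xz; rewrite edges_adj (adj_par RG) => /andP[_ h].
have step a b : [set a; b] \in F -> par a == b -> below u a = below u b.
  move=> abF /eqP pa; rewrite -pa below_par_strict //.
  by apply: contraNneq uF => <-; rewrite pa.
by case/orP: h => h; [apply: step|apply/esym/step; rewrite 1?setUC].
Qed.

(** Without the edge above [u], nothing below [u] is connected to the rest. So [F] contains every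
    edge inside [U], and also the edge above each vertex of [U] other than a shallowest one, which
    is the top. *)
Lemma connected_subgraphE (U : {set G}) F :
  connected_subgraph (U, F) = (F == induced U) && [exists v, topped v U].
Proof.
apply/idP/andP.
  case/and4P => /= /set0Pn[x0 x0U] FE FU /forall_inP conF.
  have con x y : x \in U -> y \in U -> connect (fun a b => [set a; b] \in F) x y.
    by move=> xU yU; have /forall_inP := conF x xU; apply.
  have edge_in u : u \in U -> par u \in U -> u != c -> [set u; par u] \in F.
    move=> uU pU uc; apply/negPn/negP => uF.
    have := below_closed FE uF (con _ _ uU pU); rewrite below_refl => /esym.
    by move/(below_dp_le RG); rewrite (dp_par RG uc) ltnn.
  split.
    rewrite eqEsubset; apply/andP; split; apply/subsetP => e.
      move=> eF; rewrite inE (subsetP FE) //.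
      by move/forall_inP: FU; apply.
    rewrite inE => /andP[/edgesP[x xc ->]]; rewrite subUset !sub1set => /andP[xU pU].
    exact: edge_in.
  case: (arg_minnP (P := mem U) dp x0U) => v vU vmin.
  apply/existsP; exists v; apply/toppedP; split=> // u uU uv.
  suff uF : [set u; par u] \in F.
    split.
      apply/negP => /eqP uc; move: (subsetP FE _ uF).
      by rewrite edges_adj uc (par_root RG) adj_irrefl.
    by move/forall_inP: FU => /(_ _ uF); rewrite subUset !sub1set => /andP[].
  apply/negPn/negP => uF; have := below_closed FE uF (con _ _ uU vU).
  rewrite below_refl => /esym bv; case/eqP: uv.
  exact: (below_dp_eq RG bv (vmin _ uU)).
case=> /eqP-> /existsP[v tv]; have [vU H] := toppedP _ _ tv.
apply/and4P; split=> /=.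
- by apply/set0Pn; exists v.
- by apply/subsetP => e; rewrite inE => /andP[].
- by apply/forall_inP => e; rewrite inE => /andP[].
pose r a b := [set a; b] \in induced U.
have r_sym : symmetric r by move=> a b; rewrite /r setUC.
have con u : u \in U -> connect r v u.
  move: {2}(dp u) (erefl (dp u)) => n; elim: n u => [|n IHn] u du uU.
    have [->|uv] := eqVneq u v; first exact: connect0.
    by have [uc _] := H u uU uv; move/eqP: du; rewrite (dp_eq0 RG) (negPf uc).
  have [->|uv] := eqVneq u v; first exact: connect0.
  have [uc pU] := H u uU uv.
  apply: connect_trans (IHn (par u) _ pU) (connect1 _).
    by rewrite (dp_par_le RG) du.
  rewrite /r inE edges_adj subUset !sub1set uU pU adj_sym !andbT.
  exact: (adj_par_self RG uc).
apply/forall_inP => x xU; apply/forall_inP => y yU.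
by apply: connect_trans (con y yU); rewrite (sym_connect_sym r_sym) con.
Qed.

(** A connected subgraph is determined by its vertex set, and this has exactly one top. *)
Lemma num_subtrees_sum : num_subtrees G = \sum_v subtree_count v.
Proof.
have -> : num_subtrees G = #|[set U : {set G} | [exists v, topped v U]]|.
  rewrite -(card_imset (mem [set U : {set G} | [exists v, topped v U]])
             (f := fun U => (U, induced U))); last by move=> U V [].
  apply: eq_card => -[U F]; rewrite inE connected_subgraphE.
  apply/andP/imsetP => [[/eqP-> tU]|[V]]; first by exists U; rewrite ?inE.
  by rewrite inE => tV [-> ->].
rewrite -sum1dep_card /subtree_count.
under [RHS]eq_bigr => v _ do rewrite -sum1dep_card big_mkcond /=.
rewrite exchange_big big_mkcond /=; apply: eq_bigr => U _.
case: existsP => [[v tv]|no]; last first.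
  by rewrite big1 // => v _; case: ifP => // tv; case: no; exists v.
rewrite (bigD1 v) //= tv big1 // => w wv; case: ifP => // tw.
by rewrite (topped_uniq tv tw) eqxx in wv.
Qed.

End Counting.

(** * The recursion for the number of subtrees with a given top *)

Section Recursion.
Variables (G : sgraph) (c : G) (par : G -> G) (dp : G -> nat).
Hypothesis RG : rooted c par dp.
Implicit Types (x y u v w : G) (U : {set G}).
Local Notation below := (below par).
Local Notation topped := (topped c par).
Local Notation count_at := (subtree_count c par).

Lemma topped_climb v w U x :
  topped v U -> x \in U -> below w x -> below v w -> w \in U.
Proof.
case/toppedP => vU H; move: {2}(dp x) (erefl (dp x)) => n.
elim: n x => [|n IHn] x dx xU wx vw; have [xw|xw] := eqVneq x w; try by rewrite -xw.
  by case/eqP: xw; apply/esym/(below_dp_eq RG wx); rewrite dx.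
have xv : x != v.
  apply: contraNneq xw => xv; apply/eqP/esym/(below_dp_eq RG wx).
  by rewrite xv (below_dp_le RG).
have [xc pU] := H x xU xv.
by apply: IHn pU _ vw; rewrite ?(dp_par_le RG) ?dx // -below_par_strict.
Qed.

(** A subtree with top [v] amounts to an independent choice, for each child [w], of nothing or of a
    subtree with top [w]. The choices are encoded as functions in a [pfamily], with [set0] for
    nothing. *)
Lemma subtree_countE v :
  count_at v = \prod_(w | (w != c) && (par w == v)) (count_at w).+1.
Proof.
pose D := [pred w | (w != c) && (par w == v)].
pose F w := [pred U | (U == set0) || topped w U].
pose Phi (g : {ffun G -> {set G}}) := v |: \bigcup_(w in D) g w.
have dpD w : w \in D -> dp w = (dp v).+1.
  by case/andP => wc /eqP <-; apply: (dp_par RG).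
have topN w U : topped w U -> U != set0.
  by case/toppedP => wU _; apply/set0Pn; exists w.
(* The choice at [w] is recovered by intersecting with the branch of [w]; hence [Phi] is
   injective. *)
have Phi_cap g w : g \in pfamily set0 D F -> w \in D ->
    Phi g :&: [set x | below w x] = g w.
  case/pfamilyP => _ Fg wD; apply/setP => x; rewrite !inE.
  apply/andP/idP => [[xP wx]|xg].
    move: xP; case: eqP => [xv|_ /bigcupP[u uD xu]].
      by move/(below_dp_le RG): wx; rewrite xv (dpD w) // ltnn.
    have /orP[/eqP gu|tu] := Fg u uD; first by rewrite gu inE in xu.
    have ux := topped_below RG tu xu.
    have uw : below u w by apply: (below_total RG ux wx); rewrite (dpD u) // (dpD w).
    by rewrite -(below_dp_eq RG uw) // (dpD u) // (dpD w).
  have /orP[/eqP gw|tw] := Fg w wD; first by rewrite gw inE in xg.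
  split; last exact: (topped_below RG tw xg).
  by apply/orP; right; apply/bigcupP; exists w.
have -> : \prod_(w | D w) (count_at w).+1 = #|pfamily set0 D F|.
  have FE w : #|F w| = (count_at w).+1.
    have := cardU1 set0 [set U | topped w U]; rewrite inE.
    case: (boolP (topped w set0)) => [/topN|_ cE]; first by rewrite eqxx.
    rewrite /count_at -add1n -[X in X + _]/(~~ false : nat) -cE.
    by apply: eq_card => U; rewrite !inE.
  transitivity (\prod_(w <- enum D) (count_at w).+1); first by rewrite big_enum.
  rewrite card_pfamily /image_mem.
  by elim: (enum D) => [|w s IHs] /=; rewrite ?big_nil // big_cons IHs FE.
rewrite -(card_in_imset (f := Phi)); last first.
  move=> g h gF hF gh; apply/ffunP => w; have [wD|wD] := boolP (w \in D).
    by rewrite -(Phi_cap g) // -(Phi_cap h) // gh.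
  have out k : k \in pfamily set0 D F -> k w = set0.
    case/pfamilyP => /subsetP sk _; apply/eqP; apply: contraNT wD => kw.
    by apply: sk.
  by rewrite !out.
apply: eq_card => U; rewrite inE; apply/idP/imsetP => [tU|[g gF ->]].
  have [vU H] := toppedP _ _ _ _ tU.
  exists [ffun w => if w \in D then U :&: [set x | below w x] else set0].
    apply/pfamilyP; split.
      by apply/subsetP => w; rewrite !inE ffunE inE; case: ifP; rewrite ?eqxx.
    move=> w wD; rewrite ffunE wD inE.
    case: (boolP (_ == _)) => //= /set0Pn[x]; rewrite !inE => /andP[xU wx].
    have vw : below v w.
      by case/andP: wD => _ /eqP <-; apply/below_par/below_refl.
    apply/toppedP; split.
      by rewrite !inE below_refl (topped_climb tU xU wx vw).
    move=> u; rewrite !inE => /andP[uU wu] uw.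
    have uv : u != v.
      apply: contraTneq wu => ->; apply/negP => /(below_dp_le RG).
      by rewrite (dpD w) // ltnn.
    by have [-> ->] := H u uU uv; rewrite -below_par_strict.
  apply/setP => x; rewrite !inE; have [->|xv] := eqVneq x v => //=.
  apply/idP/bigcupP => [xU|[w wD]]; last by rewrite ffunE wD inE => /andP[].
  have vx := topped_below RG tU xU.
  have : below v x = (x == v) + \sum_(w | (w != c) && (par w == v)) below w x :> nat.
    exact: (below_children RG).
  rewrite vx (negPf xv) add0n.
  case: (pickP [pred w in D | below w x]) => [w /andP[wD wx] _|no].
    by exists w => //; rewrite ffunE wD !inE xU.
  by rewrite big1 // => w wD; have := no w; rewrite /= [w \in D]wD /= => ->.
have /pfamilyP[_ Fg] := gF.
apply/toppedP; split; first by rewrite !inE eqxx.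
move=> u; rewrite !inE => /orP[->//|/bigcupP[w wD uw] uv].
have /orP[/eqP gw|tw] := Fg w wD; first by rewrite gw inE in uw.
have [wg H] := toppedP _ _ _ _ tw.
have [->|uNw] := eqVneq u w.
  by case/andP: wD => -> ->.
have [-> pu] := H u uw uNw; split=> //.
by apply/orP; right; apply/bigcupP; exists w.
Qed.
End Recursion.

(** * Levels around the centre *)

(* [e] tells whether the diameter is even.  If it is odd, [c] and its child [r] are
   the two centres, and the shift outside the branch of [r] gives both level 1. *)
Definition level (T : finType) (par : T -> T) (dp : T -> nat) (e : bool) (r x : T) :=
  dp x + (~~ e && ~~ below par r x).

(** The number [h] is the radius. The vertices [a] and [b] witness that both sides of the edge from
    [r] to [c] reach the lowest level; their ancestors are the two vertices singled out on each
    level. *)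
Record branched (G : sgraph) (c : G) (par : G -> G) (dp : G -> nat)
    (e : bool) (h : nat) (r a b : G) : Prop := Branched {
  br_rooted : rooted c par dp;
  br_neq : r != c;
  br_par : par r = c;
  br_level_le : forall x, level par dp e r x <= h;
  br_a_out : ~~ below par r a;
  br_b_in : below par r b;
  br_level_a : level par dp e r a = h;
  br_level_b : level par dp e r b = h }.

Section Branched.
Variables (G : sgraph) (c : G) (par : G -> G) (dp : G -> nat).
Variables (e : bool) (h : nat) (r a b : G).
Hypothesis BG : branched c par dp e h r a b.
Implicit Types (x y u v w : G).
Local Notation below := (below par).
Local Notation lev := (level par dp e r).
Let RG := br_rooted BG.
Let rc := br_neq BG.
Let pr := br_par BG.

Lemma dp_branch : dp r = 1.
Proof. by rewrite (dp_par RG rc) pr (dp_root RG). Qed.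

Lemma root_out : ~~ below r c.
Proof. by apply/negP => /(below_dp_le RG); rewrite dp_branch (dp_root RG). Qed.

Lemma level_branch : lev r = 1.
Proof. by rewrite /level below_refl andbF addn0 dp_branch. Qed.

Lemma level_root : lev c = ~~ e.
Proof. by rewrite /level root_out andbT (dp_root RG). Qed.

Lemma height_gt0 : 0 < h.
Proof. by rewrite -level_branch (br_level_le BG). Qed.

Lemma below_branch_par x : x != r -> below r (par x) = below r x.
Proof. by move=> xr; rewrite -below_par_strict. Qed.

Lemma level_par x : x != c -> x != r -> lev x = (lev (par x)).+1.
Proof. by move=> xc xr; rewrite /level below_branch_par // (dp_par RG xc). Qed.

Lemma level_gt1 x : 1 < lev x -> x != c /\ x != r.
Proof.
move=> x1; split; apply: contraTneq x1 => ->.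
  by rewrite level_root; case: (e).
by rewrite level_branch.
Qed.

Lemma level0 x : lev x = 0 -> e /\ x = c.
Proof.
rewrite /level => /eqP; rewrite addn_eq0 (dp_eq0 RG) => /andP[/eqP-> ].
by rewrite root_out andbT; case: (e).
Qed.

Lemma level_lt_odd x : ~~ e -> lev x = 1 -> x = c \/ x = r.
Proof.
move=> e0 x1; have [->|xc] := eqVneq x c; first by left.
have [->|xr] := eqVneq x r; first by right.
by move: x1; rewrite level_par // => -[/level0[]]; rewrite (negPf e0).
Qed.

(** A farthest vertex is [a] or [b], whichever is on the other side of the cut edge. For odd
    diameter the shift of levels counts the crossing one too often, hence the correction [~~ e]. *)
Lemma branched_ecc x : ecc x = lev x + (h - ~~ e).
Proof.
have h0 := height_gt0.
have le y : dist x y <= lev x + (h - ~~ e).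
  have := br_level_le BG x; have := br_level_le BG y; rewrite /level.
  case: (boolP (below r x)) => rx; case: (boolP (below r y)) => ry.
  - by have := dist_common_le RG rc rx ry; case: (e) => /=; lia.
  - by have := dist_branch RG rc pr rx ry; case: (e) => /=; lia.
  - have := dist_branch RG rc pr ry rx.
    by rewrite !(dist_sep RG) sepC; case: (e) => /=; lia.
  - by have := dist_dp_le RG x y; case: (e) => /=; lia.
apply/eqP; rewrite eqn_leq; apply/andP; split; first by apply/bigmax_leqP.
case: (boolP (below r x)) => rx.
  apply: (leq_trans _ (leq_bigmax a)); rewrite (dist_branch RG rc pr rx (br_a_out BG)).
  by have := br_level_a BG; rewrite /level rx (br_a_out BG); case: (e) => /=; lia.
apply: (leq_trans _ (leq_bigmax b)); rewrite (dist_sep RG) sepC -(dist_sep RG).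
rewrite (dist_branch RG rc pr (br_b_in BG) rx).
by have := br_level_b BG; rewrite /level rx (br_b_in BG); case: (e) => /=; lia.
Qed.

(* The following weights belong to the forest obtained by deleting the edge from
   [r] to [c]: removing it puts the two sides of [G] on the same footing. *)
Definition side_size v :=
  if v == c then #|G| - subtree_size par r else subtree_size par v.

Definition side_child v w := [&& w != c, w != r & par w == v].

Definition side_count v := \prod_(w | side_child v w) (subtree_count c par w).+1.

Lemma side_child_eq v : v != c ->
  (fun w => (w != c) && (par w == v)) =1 side_child v.
Proof.
move=> vc w; rewrite /side_child; case: (w != c) => //=.
by case: (eqVneq w r) => //= ->; rewrite pr eq_sym (negPf vc).
Qed.

Lemma side_countN v : v != c -> side_count v = subtree_count c par v.
Proof.
by move=> vc; rewrite (subtree_countE RG); apply: eq_bigl => w; rewrite side_child_eq.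
Qed.

Lemma side_sizeN v : v != c -> side_size v = subtree_size par v.
Proof. by rewrite /side_size => /negPf->. Qed.

Lemma side_countE v : side_count v = \prod_(w | side_child v w) (side_count w).+1.
Proof. by apply: eq_bigr => w /andP[wc _]; rewrite side_countN. Qed.

Lemma subtree_count_root :
  subtree_count c par c = side_count c * (side_count r).+1.
Proof.
rewrite (subtree_countE RG) (bigD1 r) /= ?rc ?pr ?eqxx // mulnC (side_countN rc).
rewrite /side_count; congr (_ * _); apply: eq_bigl => w; rewrite /side_child.
by rewrite -andbA [_ && (w != r)]andbC.
Qed.

Lemma side_size_root : side_size c = (\sum_(w | side_child c w) side_size w).+1.
Proof.
rewrite /side_size eqxx -(subtree_size_root RG) (subtree_sizeE RG).
rewrite (bigD1 r) /= ?rc ?pr ?eqxx // -addnS addKn; congr _.+1.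
apply: eq_big => [w|w /andP[/andP[/negPf-> _] _]//].
by rewrite /side_child; case: (w != c) => //=; rewrite andbC.
Qed.

Lemma side_sizeE v : side_size v = (\sum_(w | side_child v w) side_size w).+1.
Proof.
have [->|vc] := eqVneq v c; first exact: side_size_root.
rewrite side_sizeN // (subtree_sizeE RG); congr _.+1.
by apply: eq_big => [w|w /andP[wc _]]; rewrite ?side_child_eq // side_sizeN.
Qed.

Lemma side_size_gt0 v : 0 < side_size v.
Proof. by rewrite side_sizeE. Qed.

Lemma side_size_le v : side_size v <= #|G|.
Proof.
by rewrite /side_size; case: eqP => _; [apply: leq_subr|apply: subtree_size_le].
Qed.

Lemma side_count_gt0 v : 0 < side_count v.
Proof. by rewrite prodn_gt0. Qed.

Definition lset k : {set G} := [set x | lev x == k].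

Lemma mem_lset x k : (x \in lset k) = (lev x == k).
Proof. by rewrite inE. Qed.

Lemma lset_child k v w : 0 < k -> v \in lset k ->
  (w \in lset k.+1) && (par w == v) = side_child v w.
Proof.
rewrite mem_lset => k0 /eqP vk; rewrite mem_lset; apply/idP/idP.
  case/andP => /eqP wk pw; have [wc wr] := @level_gt1 w ltac:(by rewrite wk).
  by rewrite /side_child wc wr.
case/and3P => wc wr pw; rewrite pw andbT level_par // (eqP pw) vk.
by [].
Qed.

Lemma lset_par k w : 0 < k -> w \in lset k.+1 -> par w \in lset k.
Proof.
rewrite !mem_lset => k0 /eqP wk; have [wc wr] := @level_gt1 w ltac:(by rewrite wk).
by move/eqP: wk; rewrite level_par.
Qed.

(** From level 2 on, every vertex is a [side_child] of a vertex one level higher. This fails on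
    level 1, where [r] was cut off. *)
Lemma big_lset (R : Type) (idx : R) (op : Monoid.com_law idx) k (F : G -> R) :
  0 < k ->
  \big[op/idx]_(v in lset k) \big[op/idx]_(w | side_child v w) F w =
  \big[op/idx]_(w in lset k.+1) F w.
Proof.
move=> k0; rewrite [RHS](partition_big par (mem (lset k))) /=; last first.
  by move=> w; apply: lset_par.
by apply: eq_bigr => v vk; apply: eq_bigl => w; rewrite lset_child.
Qed.

(** By downward induction, the total on a level depends on the level sizes alone. *)
Lemma level_size_sum k : 0 < k ->
  \sum_(v in lset k) side_size v = #|lset k| + \sum_(w in lset k.+1) side_size w.
Proof.
move=> k0; rewrite (eq_bigr _ (fun v _ => side_sizeE v)) -big_lset //.
by rewrite -sum1_card -big_split.
Qed.

Lemma level_count_prod k : 0 < k ->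
  \prod_(v in lset k) side_count v = \prod_(w in lset k.+1) (side_count w).+1.
Proof. by move=> k0; rewrite (eq_bigr _ (fun v _ => side_countE v)) big_lset. Qed.

(** One plus a sum is at most the product of the terms increased by one. This transfers to counts
    the lower bounds for sizes, and back to sizes what equality of counts forces. *)
Lemma side_size_le_count v : side_size v <= side_count v.
Proof.
move: {2}(h - lev v) (leqnn (h - lev v)) => n; elim: n v => [|n IHn] v le_n.
  have no w : side_child v w = false.
    apply/negP => /and3P[wc wr /eqP pw].
    by have := level_par wc wr; have := br_level_le BG w; rewrite pw; lia.
  by rewrite side_sizeE side_countE !big_pred0.
rewrite side_sizeE side_countE.
have le w : side_child v w -> side_size w <= side_count w.
  move=> /and3P[wc wr /eqP pw]; apply: IHn; have := level_par wc wr.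
  by rewrite pw; lia.
elim/big_rec2: _ => // w p s cw h1.
rewrite mulSn -addnS addnC; apply: leq_add => //.
by apply: leq_trans (le w cw) _; apply: leq_pmulr; case: (p) h1.
Qed.

(** For [z] on level [h], the ancestor of [z] on level [k]. *)
Definition chain z k := iter (h - k) par z.

Lemma chain_step z k : k < h -> chain z k = par (chain z k.+1).
Proof. by move=> kh; rewrite /chain -iterS subnSK. Qed.

Lemma chain_level z k : lev z = h -> 0 < k <= h ->
  lev (chain z k) = k /\ below r (chain z k) = below r z.
Proof.
move=> zh /andP[k0 kh]; rewrite -(subKn kh) in k0 *; move: (h - k) k0 => i.
elim: i {k kh} => [|i IHi] ih; first by rewrite subn0 /chain subnn.
have [|l1 l2] := IHi; first by lia.
have [wc wr] : chain z (h - i) != c /\ chain z (h - i) != r.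
  by apply: level_gt1; rewrite l1; lia.
rewrite chain_step; last by lia.
rewrite subnSK; last by lia.
rewrite below_branch_par //; split=> //.
by have := level_par wc wr; rewrite l1; lia.
Qed.

Lemma chain_child z k : lev z = h -> 0 < k -> k < h ->
  side_child (chain z k) (chain z k.+1).
Proof.
move=> zh k0 kh; have [|l1 _] := @chain_level z k.+1 zh; first by lia.
have [wc wr] : chain z k.+1 != c /\ chain z k.+1 != r.
  by apply: level_gt1; rewrite l1; lia.
by rewrite /side_child wc wr (chain_step z kh) eqxx.
Qed.

Lemma chain_size z k : lev z = h -> 0 < k <= h -> h - k < side_size (chain z k).
Proof.
move=> zh /andP[k0 kh]; rewrite -(subKn kh) in k0 *; move: (h - k) k0 => i.
elim: i {k kh} => [|i IHi] ih; first by rewrite subn0 subnn side_size_gt0.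
have := chain_child zh ih; rewrite subnSK; last by lia.
move/(_ ltac:(lia)) => ch; rewrite side_sizeE (bigD1 _ ch) /=.
by have := IHi ltac:(lia); lia.
Qed.

Lemma chain_count z k : lev z = h -> 0 < k <= h -> h - k < side_count (chain z k).
Proof.
by move=> zh kh; apply: leq_trans (chain_size zh kh) (side_size_le_count _).
Qed.

Lemma chain_neq k : 0 < k <= h -> chain a k != chain b k.
Proof.
move=> kh; have [_ ba] := chain_level (br_level_a BG) kh.
have [_ bb] := chain_level (br_level_b BG) kh.
apply: contraNneq (br_a_out BG) => ab.
by rewrite -ba ab bb (br_b_in BG).
Qed.

Lemma sum_levels (F : G -> nat) :
  \sum_(v | 0 < lev v) F v = \sum_(k < h) \sum_(v in lset k.+1) F v.
Proof.
have lt v : (lev v).-1 < h by have := br_level_le BG v; have := height_gt0; lia.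
rewrite (partition_big (fun v => Ordinal (lt v)) predT) //=.
apply: eq_bigr => k _; apply: eq_bigl => v; rewrite mem_lset -val_eqE /=.
by lia.
Qed.

Lemma lset1_odd : ~~ e -> lset 1 = [set c; r].
Proof.
move=> e0; apply/setP => x; rewrite mem_lset !inE; apply/eqP/orP.
  by case/(level_lt_odd e0) => ->; rewrite eqxx; [left|right].
by case=> /eqP->; rewrite ?level_branch // level_root e0.
Qed.

Lemma level_gt0_even x : e -> (0 < lev x) = (x != c).
Proof.
move=> e1; apply/idP/idP => [|xc]; first by apply: contraTneq => ->; rewrite level_root e1.
by rewrite lt0n; apply: contraNneq xc => /level0[_ ->].
Qed.

Lemma level_gt0_odd x : ~~ e -> 0 < lev x.
Proof. by move=> e0; rewrite lt0n; apply/eqP => /level0[]; rewrite (negPf e0). Qed.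

Definition level_wiener k := \sum_(v in lset k) side_size v * (#|G| - side_size v).

Lemma level_wienerE k :
  level_wiener k + \sum_(v in lset k) side_size v * side_size v =
  #|G| * \sum_(v in lset k) side_size v.
Proof.
rewrite big_distrr -big_split; apply: eq_bigr => v _ /=.
by rewrite -mulnDr subnK ?side_size_le // mulnC.
Qed.

(** Every edge belongs to its lower end, except that for odd diameter level 1 consists of [c] and
    [r] and so counts the cut edge from both ends. Doubling the index avoids halving that level. *)
Lemma branched_wiener :
  2 * wiener G =
  \sum_(k < h) (if (k == 0 :> nat) && ~~ e then 1 else 2) * level_wiener k.+1.
Proof.
have -> : wiener G = \sum_(v | v != c) side_size v * (#|G| - side_size v).
  by rewrite (rooted_wiener RG); apply: eq_bigr => v vc; rewrite side_sizeN.
have [e1|e0] := boolP e.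
  under [RHS]eq_bigr => k _ do rewrite andbF.
  rewrite -big_distrr -sum_levels; congr (_ * _).
  by apply: eq_bigl => v; rewrite level_gt0_even.
have tot : \sum_v side_size v * (#|G| - side_size v) = \sum_(k < h) level_wiener k.+1.
  by rewrite -sum_levels; apply: eq_bigl => v; rewrite level_gt0_odd.
have W1 : level_wiener 1 = 2 * (side_size c * (#|G| - side_size c)).
  rewrite /level_wiener lset1_odd // (big_setD1 c) ?set21 //= (big_setD1 r) /=; last first.
    by rewrite !inE rc eqxx orbT.
  rewrite big1 ?addn0; last by move=> i; rewrite !inE => /and3P[/negPf-> /negPf->].
  rewrite mul2n -addnn; congr (_ + _); rewrite (side_sizeN rc) /side_size eqxx.
  by rewrite mulnC subKn ?subtree_size_le.
case: (h) height_gt0 tot => // n _; rewrite [X in _ = X -> _]big_ord_recl (bigD1 c) //=.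
rewrite [X in _ -> _ = X]big_ord_recl /= W1 => tot.
rewrite -[X in _ = _ + X]big_distrr /=; move: tot.
set X := side_size c * _; set Y := \sum_(v | v != c) _; set Z := \sum_(i < n) _.
by lia.
Qed.

Lemma lset1_even : e -> lset 1 = [set w | (w != c) && (par w == c)].
Proof.
move=> e1; apply/setP => w; rewrite mem_lset inE; have [->|wc] := eqVneq w c.
  by rewrite level_root e1.
have [->|wr] := eqVneq w r; first by rewrite level_branch pr !eqxx.
rewrite level_par // eqSS; apply/eqP/eqP => [/level0[]//|->].
by rewrite level_root e1.
Qed.

(** The last term counts what the sum over the levels omits: for even diameter the subtrees
    containing [c], with level 1 the children of [c]; for odd diameter those containing the edge
    between [c] and [r]. *)
Lemma branched_num_subtrees :
  num_subtrees G = \sum_(k < h) \sum_(v in lset k.+1) side_count v +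
    (if e then \prod_(v in lset 1) (side_count v).+1
     else \prod_(v in lset 1) side_count v).
Proof.
rewrite (num_subtrees_sum RG) (bigD1 c) //= addnC.
have -> : \sum_(v | v != c) subtree_count c par v = \sum_(v | v != c) side_count v.
  by apply: eq_bigr => v vc; rewrite side_countN.
case: ifP => [e1|/negbT e0]; rewrite -sum_levels.
  congr (_ + _); first by apply: eq_bigl => v; rewrite level_gt0_even.
  rewrite (subtree_countE RG) lset1_even //; apply: eq_big => [w|w /andP[wc _]].
    by rewrite inE.
  by rewrite side_countN.
rewrite [in RHS](eq_bigl predT) => [|v]; last by rewrite level_gt0_odd.
rewrite [in RHS](bigD1 c) //= subtree_count_root lset1_odd //.
rewrite (big_setD1 c) ?set21 //= (big_setD1 r) /=; last by rewrite !inE rc eqxx orbT.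
rewrite [X in _ * (_ * X)]big1; last by move=> i; rewrite !inE => /and3P[/negPf-> /negPf->].
by rewrite muln1 mulnS; lia.
Qed.
End Branched.

Lemma dist_le_ecc (G : sgraph) (x y : G) : dist x y <= ecc x.
Proof. exact: leq_bigmax. Qed.

Lemma ecc_attained (G : sgraph) (x : G) : exists y, dist x y = ecc x.
Proof.
have G0 : 0 < #|G| by apply/card_gt0P; exists x.
by have [y yE] := eq_bigmax (dist x) G0; exists y; apply: esym yE.
Qed.

(** The root [c] is a vertex of least eccentricity [R], the vertex [b] is farthest from it, and [r]
    is the first vertex on the way from [c] to [b]. *)
Lemma tree_branched (G : sgraph) : is_tree G -> 1 < #|G| ->
  exists c par dp e h r a b, @branched G c par dp e h r a b.
Proof.
move=> tG n1; have /card_gt0P[x0 _] : 0 < #|G| by apply: ltnW.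
case: (@arg_minnP G x0 xpredT (@ecc G) isT) => c _ cmin.
have [par RG] := tree_rooted tG c; set dp := fun x => dist c x in RG.
have [b bR] := ecc_attained c; set R := ecc c in bR cmin.
have dpR x : dp x <= R by apply: dist_le_ecc.
have R0 : 0 < R.
  have [x xc] : exists x, x != c.
    have: 0 < #|predC1 c| by rewrite cardC1; lia.
    by case/card_gt0P => x xc; exists x.
  by rewrite -(dp_gt0 RG) in xc; apply: leq_trans xc (dpR x).
pose r := iter R.-1 par b.
have br : below par r b by apply: fconnect_iter.
have dr : dp r = 1 by rewrite (dp_iter_par RG) /dp bR; lia.
have rc : r != c by rewrite -(dp_gt0 RG) dr.
have pr : par r = c by apply/eqP; rewrite -(dp_eq0 RG) (dp_par_le RG) dr.
(* The eccentricity of [r] is at least [R], whereas inside its branch distances from [r] are below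
   [R]. So a vertex farthest from [r] lies outside. *)
have [a a_out da] : exists2 a, ~~ below par r a & R <= (dp a).+1.
  have [a ra] := ecc_attained r; have := cmin r isT; rewrite -ra => Ra.
  have : ~~ below par r a.
    apply: contraL Ra => h; rewrite -ltnNge (dist_below RG) // dr.
    by have := dpR a; lia.
  move=> h; exists a => //; move: Ra.
  by rewrite (dist_branch RG rc pr (below_refl _ _) h) dr.
(* If depth [R] occurs outside the branch of [r], the diameter is [2R]. Otherwise the largest depth
   there is [R - 1], and the shift in [level] turns it into [R]. *)
case: (pickP [pred x | ~~ below par r x & dp x == R]) => [w /andP[/= w_out /eqP wR]|no].
  exists c, par, dp, true, R, r, w, b; split=> //.
  - by move=> x; rewrite /level addn0.
  - by rewrite /level addn0.
  - by rewrite /level addn0.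
exists c, par, dp, false, R, r, a, b.
have lt x : ~~ below par r x -> dp x < R.
  by move=> rx; have := no x; rewrite /= rx /= ltn_neqAle dpR => ->.
split=> //.
- move=> x; rewrite /level /=; case: (boolP (below par r x)) => [_|/lt]; last by rewrite addn1.
  by rewrite addn0.
- by rewrite /level a_out /= addn1; have := lt a a_out; lia.
- by rewrite /level br addn0.
Qed.

(** * Convexity on one level *)

Lemma sum_ge_size (T : eqType) (r : seq T) (s : T -> nat) :
  (forall x, x \in r -> 0 < s x) -> size r <= \sum_(x <- r) s x.
Proof.
move=> s0; rewrite -sum1_size big_seq [X in _ <= X]big_seq.
by apply: leq_sum => x xr; apply: s0.
Qed.

Lemma sum_eq_size (T : eqType) (r : seq T) (s : T -> nat) :
  (forall x, x \in r -> 0 < s x) -> \sum_(x <- r) s x = size r ->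
  forall x, x \in r -> s x = 1.
Proof.
elim: r => // x r IHr sr; rewrite big_cons /= => sE.
have x0 := sr x (mem_head _ _).
have sr' z : z \in r -> 0 < s z by move=> zr; apply: sr; rewrite inE zr orbT.
have := sum_ge_size sr'; move=> le z; rewrite inE => /predU1P[->|]; first by lia.
by apply: IHr => //; lia.
Qed.

(** Convexity: each entry is lowered to 1 and its excess is moved to [X], which changes nothing only
    if there is no excess or [X] is 1. *)
Lemma sum_squares_le (T : eqType) (r : seq T) (s : T -> nat) (X d : nat) :
  (forall x, x \in r -> 0 < s x) -> 0 < X ->
  \sum_(x <- r) s x = size r + d ->
  X * X + \sum_(x <- r) s x * s x <= (X + d) * (X + d) + size r /\
  (1 < X -> 0 < d ->
   X * X + \sum_(x <- r) s x * s x < (X + d) * (X + d) + size r).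
Proof.
elim: r X d => [|x r IHr] X d sr X0; rewrite ?big_nil ?big_cons /= ?big_nil ?big_cons.
  by rewrite add0n => <-; split=> //; rewrite !addn0.
have x0 := sr x (mem_head _ _).
have sr' z : z \in r -> 0 < s z by move=> zr; apply: sr; rewrite inE zr orbT.
have size_le := sum_ge_size sr'.
move=> dE; have X'0 : 0 < X + (s x).-1 by lia.
have [k sk] : exists k, s x = k.+1 by exists (s x).-1; lia.
have [d' dE'] : exists d', d = k + d' by exists (d - k); lia.
have [h1 h2] := IHr (X + k) d' sr' ltac:(lia) ltac:(lia).
rewrite sk dE' addnA in h1 h2 *; move: h1 h2; move: (\sum_(z <- r) s z * s z) => Q.
have -> : X + (k + d') = X + k + d' by lia.
have kX : k <= X * k by rewrite leq_pmull.
have kX2 : 1 < X -> k + k <= X * k by move=> X1; rewrite addnn -mul2n leq_mul.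
move: ((X + k + d') * (X + k + d')) => P h1 h2; split; first by nia.
move=> X1; have := kX2 X1; case: (posnP k) => [k0 _|k0]; last by nia.
move: h1 h2; rewrite k0 addn0 add0n => h1 h2 d0.
by have := h2 X1 d0; lia.
Qed.

(** The multiplicative merging: replacing positive [u], [v] by [u * v] and 1 lowers neither the sum
    nor the product of the successors, as [(u - 1) * (v - 1)] is nonnegative. *)
Lemma prod_ge1_le (T : eqType) (r : seq T) (f : T -> nat) (X : nat) :
  (forall x, x \in r -> 0 < f x) -> 0 < X ->
  [/\ X + \sum_(x <- r) f x <= X * \prod_(x <- r) f x + size r,
      1 < X -> X + \sum_(x <- r) f x = X * \prod_(x <- r) f x + size r ->
        forall x, x \in r -> f x = 1 &
      X.+1 * \prod_(x <- r) (f x).+1 <= 2 ^ size r * (X * \prod_(x <- r) f x).+1].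
Proof.
elim: r X => [|x r IHr] X fr X0.
  by rewrite !big_nil !muln1 expn0 mul1n; split.
have x0 := fr x (mem_head _ _).
have fr' z : z \in r -> 0 < f z by move=> zr; apply: fr; rewrite inE zr orbT.
have [h1 h2 h3] := IHr (X * f x) fr' ltac:(by rewrite muln_gt0 X0).
rewrite !big_cons /= !mulnA.
move: h1 h2 h3; set S := \sum_(z <- r) f z; set P := X * f x * _.
set Q := \prod_(z <- r) (f z).+1 => h1 h2 h3; split.
- by nia.
- move=> X1 eq1; have fx : f x = 1 by nia.
  move=> z; rewrite inE => /predU1P[->//|zr]; apply: h2 => //; rewrite fx muln1 //.
  by lia.
- apply: (@leq_trans (2 * ((X * f x).+1 * Q))).
    by rewrite !mulnA leq_mul2r; apply/orP; right; nia.
  by rewrite expnS -[2 * _ * _]mulnA leq_mul2l.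
Qed.

Section Extremal.
Variables (T : finType) (L : {set T}) (a b : T).
Hypotheses (aL : a \in L) (bL : b \in L) (ab : a != b).
Local Notation rest := (L :\ a :\ b).

Lemma big_two (R : Type) (idx : R) (op : Monoid.com_law idx) (F : T -> R) :
  \big[op/idx]_(x in L) F x =
  op (F a) (op (F b) (\big[op/idx]_(x in rest) F x)).
Proof.
rewrite (big_setD1 a) //= (big_setD1 b) //=.
by rewrite !inE eq_sym ab.
Qed.

Lemma card_rest : #|rest| = #|L| - 2.
Proof.
rewrite (cardsD1 a L) aL (cardsD1 b (L :\ a)) !inE eq_sym ab bL.
by rewrite !add1n subn2.
Qed.

Lemma mem_rest x : (x \in rest) = [&& x != b, x != a & x \in L].
Proof. by rewrite !inE. Qed.

(** All excess over 1 outside [a] and [b] is moved to [a]; then the two remaining values, both at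
    least [y], are pushed apart to [y] and [z]. *)
Lemma extremal_squares (s : T -> nat) (y z : nat) :
  (forall x, x \in L -> 0 < s x) -> 0 < y -> y <= s a -> y <= s b ->
  \sum_(x in L) s x = y + z + (#|L| - 2) ->
  \sum_(x in L) s x * s x <= y * y + z * z + (#|L| - 2) /\
  (\sum_(x in L) s x * s x = y * y + z * z + (#|L| - 2) -> 1 < y ->
   (forall x, x \in L -> x != a -> x != b -> s x = 1) /\ (s a = y \/ s b = y)).
Proof.
move=> s0 y0 ya yb; rewrite !big_two /= -card_rest -!big_enum cardE /=.
have sr x : x \in enum rest -> 0 < s x.
  by rewrite mem_enum mem_rest => /and3P[_ _ /s0].
have size_le := sum_ge_size sr.
have [d dE] : exists d, \sum_(x <- enum rest) s x = size (enum rest) + d.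
  by exists (\sum_(x <- enum rest) s x - size (enum rest)); rewrite subnKC.
have [h1 h2] := @sum_squares_le _ (enum rest) s (s a) d sr ltac:(lia) dE.
rewrite dE => tot; move: h1 h2; move: (\sum_(x <- _) s x * s x) => Q h1 h2.
have [p pE] : exists p, s a + d = y + p by exists (s a + d - y); lia.
have [q qE] : exists q, s b = y + q by exists (s b - y); lia.
have zE : z = y + p + q by lia.
rewrite pE in h1 h2; rewrite zE qE.
(* The gain of the second move is [2pq], so equality forces one of the two values to be [y]. *)
have id : y * y + (y + p + q) * (y + p + q)
        = (y + p) * (y + p) + (y + q) * (y + q) + 2 * (p * q) by lia.
rewrite id {id}; move: h1 h2.
move: (s a * s a) ((y + p) * (y + p)) ((y + q) * (y + q)) (size _) => A P B k h1 h2.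
have [m mE] : exists m, p * q = m by exists (p * q).
rewrite mE; split; first by lia.
move=> eqQ y1; have d0 : d = 0.
  by case: (posnP d) => // d0; have := h2 ltac:(lia) d0; lia.
have pq : p * q = 0 by lia.
split; last first.
  by move/eqP: pq; rewrite muln_eq0 => /orP[]/eqP; lia.
move=> x xL xa xb; have xr : x \in enum rest by rewrite mem_enum mem_rest xL xa xb.
by apply: (sum_eq_size sr) xr; rewrite dE d0 addn0.
Qed.

(** The other factors are first merged into [f a]. The second conclusion feeds the product estimate
    one level higher, the other two the sum over the level. *)
Lemma extremal_products (f : T -> nat) (y z : nat) :
  (forall x, x \in L -> 0 < f x) -> 0 < y -> y <= f a -> y <= f b ->
  \prod_(x in L) f x <= y * z ->
  [/\ \sum_(x in L) f x <= y + z + (#|L| - 2),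
      \prod_(x in L) (f x).+1 <= y.+1 * (z.+1 * 2 ^ (#|L| - 2)) &
      \sum_(x in L) f x = y + z + (#|L| - 2) -> 1 < y ->
      (forall x, x \in L -> x != a -> x != b -> f x = 1) /\ (f a = y \/ f b = y)].
Proof.
move=> f0 y0 ya yb; rewrite !big_two /= -card_rest -!big_enum cardE /=.
have fr x : x \in enum rest -> 0 < f x.
  by rewrite mem_enum mem_rest => /and3P[_ _ /f0].
have [h1 h2 h3] := @prod_ge1_le _ (enum rest) f (f a) fr ltac:(lia).
have P0 : 0 < \prod_(x <- enum rest) f x.
  by rewrite big_seq; apply: prodn_cond_gt0 => x xr; apply: fr.
move: h1 h2 h3; set S := \sum_(x <- _) _; set P := f a * \prod_(x <- _) f x.
set Q := \prod_(x <- _) (f x).+1; set k := size _ => h1 h2 h3.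
have -> : f a * (f b * \prod_(x <- enum rest) f x) = P * f b by rewrite /P; lia.
move=> le; have [p pE] : exists p, P = y + p by exists (P - y); rewrite /P; nia.
have [q qE] : exists q, f b = y + q by exists (f b - y); lia.
(* Because [(y + p)(y + q) = y(y + p + q) + pq]. *)
have pq : p + q + y <= z by rewrite pE qE in le; nia.
have pq' : (y + p) * (y + q) <= y * z by rewrite -pE -qE.
split.
- by lia.
- apply: (@leq_trans ((y + p).+1 * (y + q).+1 * 2 ^ k)); last first.
    by rewrite mulnA leq_mul2r; apply/orP; right; nia.
  rewrite -pE -qE mulnCA; apply: leq_trans (leq_mul (leqnn (f b).+1) h3) _.
  by rewrite [2 ^ k * _]mulnC mulnA [_ * P.+1]mulnC.
- move=> eqS y1; have e1 : f a + S = P + k by lia.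
  have := h2 ltac:(lia) e1 => rest1; split.
    by move=> x xL xa xb; apply: rest1; rewrite mem_enum mem_rest xL xa xb.
  have PE : P = f a.
    by rewrite /P big_seq big1 ?muln1 // => x /rest1.
  have : p * q = 0 by nia.
  by move/eqP; rewrite muln_eq0 => /orP[]/eqP; lia.
Qed.
End Extremal.

(** * Comparison with a tight tree *)

(* Equality on every level of both estimates; the caterpillar has this property. *)
Definition tight (G : sgraph) (c : G) (par : G -> G) (dp : G -> nat)
    (e : bool) (h : nat) (r : G) (al be : nat -> G) : Prop :=
  forall k, 0 < k <= h ->
  [/\ al k \in lset par dp e r k, be k \in lset par dp e r k, al k != be k,
      side_size c par r (be k) = (h - k).+1 /\ side_count c par r (be k) = (h - k).+1 &
      forall v, v \in lset par dp e r k -> v != al k -> v != be k ->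
        side_size c par r v = 1 /\ side_count c par r v = 1].

(* What equality in either estimate forces. *)
Definition rigid (G : sgraph) (c : G) (par : G -> G) (dp : G -> nat)
    (e : bool) (h : nat) (r a b : G) : Prop :=
  (forall k v, 0 < k < h -> v \in lset par dp e r k ->
     v != chain par h a k -> v != chain par h b k -> side_size c par r v = 1) /\
  (1 < h -> side_size c par r (chain par h a 1) = h \/
            side_size c par r (chain par h b 1) = h).

Lemma leq_sum_tight n (F E : nat -> nat) :
  (forall i, i < n -> F i <= E i) ->
  \sum_(i < n) F i <= \sum_(i < n) E i /\
  (\sum_(i < n) F i = \sum_(i < n) E i -> forall i, i < n -> F i = E i).
Proof.
move=> le; have le' (i : 'I_n) : true -> F i <= E i ?= iff (F i == E i).
  by move=> _; split=> //; apply: le.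
have [h1 h2] := leqif_sum le'; split=> // /eqP; rewrite h2 => /forallP eqF i i_n.
by have := eqF (Ordinal i_n) => /eqP.
Qed.

Section Compare.
Variables (e : bool) (h : nat).
Variables (G : sgraph) (c : G) (par : G -> G) (dp : G -> nat) (r a b : G).
Hypothesis BG : branched c par dp e h r a b.
Variables (H : sgraph) (c' : H) (par' : H -> H) (dp' : H -> nat) (r' a' b' : H).
Hypothesis BH : branched c' par' dp' e h r' a' b'.
Variables (al be : nat -> H).
Hypothesis tH : tight c' par' dp' e h r' al be.
Hypothesis cardE : #|G| = #|H|.
Hypothesis cardL : forall k, 0 < k -> #|lset par dp e r k| = #|lset par' dp' e r' k|.
Local Notation L := (lset par dp e r).
Local Notation L' := (lset par' dp' e r').
Local Notation s := (side_size c par r).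
Local Notation s' := (side_size c' par' r').
Local Notation f := (side_count c par r).
Local Notation f' := (side_count c' par' r').

Lemma lset_above k : h < k -> L k = set0 /\ L' k = set0.
Proof.
move=> hk; split; apply/setP => x; rewrite mem_lset inE; apply/eqP => xk.
  by have := br_level_le BG x; rewrite xk leqNgt hk.
by have := br_level_le BH x; rewrite xk leqNgt hk.
Qed.

Lemma level_size_eq k : 0 < k -> \sum_(v in L k) s v = \sum_(v in L' k) s' v.
Proof.
move: {2}(h.+1 - k) (leqnn (h.+1 - k)) => n; elim: n k => [|n IHn] k kn k0.
  have [-> ->] : L k = set0 /\ L' k = set0 by apply: lset_above; lia.
  by rewrite !big_set0.
rewrite (level_size_sum BG) // (level_size_sum BH) // cardL //; congr (_ + _).
by apply: IHn; lia.
Qed.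

Lemma chain_mem z k : level par dp e r z = h -> 0 < k <= h -> chain par h z k \in L k.
Proof. by move=> zh /(chain_level BG zh)[zk _]; rewrite mem_lset zk. Qed.

Let ha := br_level_a BG.
Let hb := br_level_b BG.

Lemma tight_big (R : Type) (idx : R) (op : Monoid.com_law idx) (F : H -> R) k :
  0 < k <= h ->
  \big[op/idx]_(v in L' k) F v =
  op (F (al k)) (op (F (be k)) (\big[op/idx]_(v in L' k :\ al k :\ be k) F v)).
Proof. by move=> kh; have [ak bk ab _ _] := tH kh; apply: big_two. Qed.

Lemma tight_rest_card k : 0 < k <= h -> #|L' k :\ al k :\ be k| = #|L' k| - 2.
Proof. by move=> kh; have [ak bk ab _ _] := tH kh; apply: card_rest. Qed.

Lemma tight_rest k v : 0 < k <= h -> v \in L' k :\ al k :\ be k -> s' v = 1 /\ f' v = 1.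
Proof.
move=> kh; have [ak bk ab _ H1] := tH kh; rewrite !in_setD1 => /and3P[? ? ?].
exact: H1.
Qed.

Lemma tight_sum_size k : 0 < k <= h ->
  \sum_(v in L' k) s' v = (h - k).+1 + s' (al k) + (#|L' k| - 2).
Proof.
move=> kh; have [_ _ _ [sb _] _] := tH kh; rewrite tight_big //= sb -tight_rest_card //.
rewrite -[X in _ = _ + X]sum1_card addnCA addnA; congr (_ + _).
by apply: eq_bigr => v /(tight_rest kh)[].
Qed.

Lemma tight_sum_squares k : 0 < k <= h ->
  \sum_(v in L' k) s' v * s' v =
  (h - k).+1 * (h - k).+1 + s' (al k) * s' (al k) + (#|L' k| - 2).
Proof.
move=> kh; have [_ _ _ [sb _] _] := tH kh; rewrite tight_big //= sb -tight_rest_card //.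
rewrite -[X in _ = _ + X]sum1_card addnCA addnA; congr (_ + _).
by apply: eq_bigr => v /(tight_rest kh)[->].
Qed.

Lemma tight_sum_count k : 0 < k <= h ->
  \sum_(v in L' k) f' v = (h - k).+1 + f' (al k) + (#|L' k| - 2).
Proof.
move=> kh; have [_ _ _ [_ sb] _] := tH kh; rewrite tight_big //= sb -tight_rest_card //.
rewrite -[X in _ = _ + X]sum1_card addnCA addnA; congr (_ + _).
by apply: eq_bigr => v /(tight_rest kh)[].
Qed.

Lemma tight_prod_count k : 0 < k <= h ->
  \prod_(v in L' k) f' v = (h - k).+1 * f' (al k).
Proof.
move=> kh; have [_ _ _ [_ sb] _] := tH kh; rewrite tight_big //= sb.
by rewrite big1 ?muln1 1?mulnC // => v /(tight_rest kh)[].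
Qed.

Lemma tight_prod_countS k : 0 < k <= h ->
  \prod_(v in L' k) (f' v).+1 = (h - k).+2 * ((f' (al k)).+1 * 2 ^ (#|L' k| - 2)).
Proof.
move=> kh; have [_ _ _ [_ sb] _] := tH kh; rewrite tight_big //= sb mulnCA.
rewrite -tight_rest_card // -prod_nat_const; congr (_ * (_ * _)).
by apply: eq_bigr => v /(tight_rest kh)[_ ->].
Qed.

(** By [level_wienerE] and the equality of the sums on the level, a smaller contribution means a
    larger sum of squares. *)
Lemma level_wiener_le k : 0 < k <= h ->
  level_wiener c' par' dp' e r' k <= level_wiener c par dp e r k /\
  (level_wiener c' par' dp' e r' k = level_wiener c par dp e r k -> k < h ->
   (forall v, v \in L k -> v != chain par h a k -> v != chain par h b k -> s v = 1) /\
   (s (chain par h a k) = (h - k).+1 \/ s (chain par h b k) = (h - k).+1)).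
Proof.
move=> kh; have k0 : 0 < k by case/andP: kh.
(* Here [y] is the number of levels from [k] to [h], and [z] the size at the first spine vertex of
   the tight tree. *)
have := @extremal_squares G (L k) _ _ (chain_mem ha kh) (chain_mem hb kh) (chain_neq BG kh)
  s (h - k).+1 (s' (al k)).
case=> //.
- by move=> x _; apply: (side_size_gt0 BG).
- exact: (chain_size BG).
- exact: (chain_size BG).
- by rewrite level_size_eq // tight_sum_size // cardL.
have := level_wienerE c par dp e r k; have := level_wienerE c' par' dp' e r' k.
rewrite level_size_eq // cardE.
rewrite tight_sum_squares // -cardL //.
have key u v w w' n : w' + u = n -> w + v = n -> v <= u -> w' <= w /\ (w' = w -> v = u).
  by lia.
move=> e1 e2 h1 h2; have [le eqQ] := key _ _ _ _ _ e1 e2 h1; split=> // eqW kh'.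
by apply: h2; [apply: eqQ|lia].
Qed.

Lemma branched_wiener_le :
  wiener H <= wiener G /\ (wiener G = wiener H -> rigid c par dp e h r a b).
Proof.
have := branched_wiener BG; have := branched_wiener BH.
pose w k := if (k == 0) && ~~ e then 1 else 2.
pose F k := w k * level_wiener c par dp e r k.+1.
pose F' k := w k * level_wiener c' par' dp' e r' k.+1.
have le k : k < h -> F' k <= F k.
  by move=> kh; have [le _] := @level_wiener_le k.+1 kh; rewrite leq_mul2l le orbT.
have [sum_le sum_eq] := leq_sum_tight le.
move=> WH WG; split; first by rewrite -(leq_pmul2l (isT : 0 < 2)) WH WG.
move=> eqW; have eqF k : k < h ->
    level_wiener c' par' dp' e r' k.+1 = level_wiener c par dp e r k.+1.
  move=> kh; have /eqP : F' k = F k by apply: sum_eq; rewrite // -[LHS]WH -[RHS]WG eqW.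
  by rewrite eqn_mul2l /w; case: ifP => //= _ /eqP.
split=> [k v /andP[k0 kh]|h1].
  have kh' : 0 < k <= h by rewrite k0 ltnW.
  have [_ H1] := level_wiener_le kh'; case: H1 => //; last by move=> H1 _; apply: H1.
  by have := eqF k.-1; rewrite prednK //; apply; lia.
have [_ H1] := @level_wiener_le 1 ltac:(lia); case: (H1 (eqF 0 ltac:(lia)) h1) => _.
by rewrite subn1 prednK // ltnW.
Qed.

(** Downward induction: the bound on level [k + 1] bounds the product of the successors there, which
    is the product on level [k]. *)
Lemma level_prod_le k : 0 < k -> \prod_(v in L k) f v <= \prod_(v in L' k) f' v.
Proof.
move: {2}(h.+1 - k) (leqnn (h.+1 - k)) => n; elim: n k => [|n IHn] k kn k0.
  have [-> ->] : L k = set0 /\ L' k = set0 by apply: lset_above; lia.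
  by rewrite !big_set0.
rewrite (level_count_prod BG) // (level_count_prod BH) //.
have [kh|hk] := ltnP k h; last first.
  have [-> ->] : L k.+1 = set0 /\ L' k.+1 = set0 by apply: lset_above.
  by rewrite !big_set0.
have kh' : 0 < k.+1 <= h by [].
rewrite tight_prod_countS // -cardL //.
have := @extremal_products G (L k.+1) _ _ (chain_mem ha kh') (chain_mem hb kh')
  (chain_neq BG kh') f (h - k.+1).+1 (f' (al k.+1)).
case=> //.
- by move=> x _; apply: side_count_gt0.
- exact: (chain_count BG).
- exact: (chain_count BG).
by rewrite -tight_prod_count // IHn //; lia.
Qed.

Lemma level_count_le k : 0 < k <= h ->
  [/\ \sum_(v in L k) f v <= \sum_(v in L' k) f' v,
      \prod_(v in L k) (f v).+1 <= \prod_(v in L' k) (f' v).+1 &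
      \sum_(v in L k) f v = \sum_(v in L' k) f' v -> k < h ->
      (forall v, v \in L k -> v != chain par h a k -> v != chain par h b k -> f v = 1) /\
      (f (chain par h a k) = (h - k).+1 \/ f (chain par h b k) = (h - k).+1)].
Proof.
move=> kh; have k0 : 0 < k by case/andP: kh.
have := @extremal_products G (L k) _ _ (chain_mem ha kh) (chain_mem hb kh)
  (chain_neq BG kh) f (h - k).+1 (f' (al k)).
case=> //.
- by move=> x _; apply: side_count_gt0.
- exact: (chain_count BG).
- exact: (chain_count BG).
- by rewrite -tight_prod_count // level_prod_le.
rewrite tight_prod_countS // tight_sum_count // -cardL // => h1 h2 h3; split=> //.
by move=> eqS lt; apply: h3; lia.
Qed.

Lemma branched_num_subtrees_le :
  num_subtrees G <= num_subtrees H /\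
  (num_subtrees G = num_subtrees H -> rigid c par dp e h r a b).
Proof.
have h0 := height_gt0 BG.
rewrite (branched_num_subtrees BG) (branched_num_subtrees BH).
set P := if e then _ else _; set P' := if e then _ else _.
(* The extra term is one of the two products over level 1, shifted or not, and both are
   estimated. *)
have lePP : P <= P'.
  have := @level_prod_le 1 isT; have [_ + _] := @level_count_le 1 h0.
  rewrite /P /P'. by case: (e).
pose F k := \sum_(v in L k.+1) f v; pose F' k := \sum_(v in L' k.+1) f' v.
have le k : k < h -> F k <= F' k by move=> kh; have [] := @level_count_le k.+1 kh.
have [] := leq_sum_tight le; rewrite /F /F'.
set S := \sum_(i < h) _; set S' := \sum_(i < h) _ => sum_le sum_eq.
split; first by apply: leq_add.
move=> eqN; have {}sum_eq := sum_eq ltac:(lia).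
(* Minimal counts are turned into minimal sizes, so that both problems lead to the same notion
   [rigid]. *)
have f1 v : f v = 1 -> s v = 1.
  move=> fv; apply/eqP; rewrite eqn_leq (side_size_gt0 BG) andbT -fv.
  exact: (side_size_le_count BG).
have fh z : level par dp e r z = h -> f (chain par h z 1) = (h - 1).+1 ->
    s (chain par h z 1) = h.
  move=> zh fz; apply/eqP; rewrite eqn_leq.
  have := side_size_le_count BG (chain par h z 1); rewrite fz.
  by have := chain_size BG zh (k := 1); lia.
split=> [k v /andP[k0 kh] vk va vb|h1].
  have kh' : 0 < k <= h by rewrite k0 ltnW.
  have [_ _ H1] := level_count_le kh'; case: H1 => //; last by move=> H1 _; apply/f1/H1.
  by have := sum_eq k.-1; rewrite prednK //; apply; lia.
have [_ _ H1] := @level_count_le 1 ltac:(lia); case: (H1 (sum_eq 0 ltac:(lia)) h1) => _.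
by case=> /fh; [left|right]; auto.
Qed.
End Compare.

(** * Trees with a spine *)

(** Each element is sent to the one that has the same label and the same position in the enumeration
    of its fibre. *)
Lemma label_bijection (V W : finType) (L : eqType) (f : V -> L) (g : W -> L) :
  (forall l, #|[set x | f x == l]| = #|[set y | g y == l]|) ->
  exists2 phi : V -> W, bijective phi & forall x, g (phi x) = f x.
Proof.
move=> eqN; pose ev (l : L) := enum [set x | f x == l].
pose ew (l : L) := enum [set y | g y == l].
have sz l : size (ev l) = size (ew l) by rewrite -!cardE.
have in_v x : x \in ev (f x) by rewrite mem_enum inE.
have in_w y : y \in ew (g y) by rewrite mem_enum inE.
have phiP x : exists y, (g y == f x) && (index y (ew (f x)) == index x (ev (f x))).
  have ix : index x (ev (f x)) < size (ew (f x)) by rewrite -sz index_mem.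
  have [y0 _] : exists y0, y0 \in ew (f x).
    by case: (ew (f x)) ix => // y0 s _; exists y0; rewrite mem_head.
  exists (nth y0 (ew (f x)) (index x (ev (f x)))).
  rewrite index_uniq ?enum_uniq // eqxx andbT.
  by have := mem_nth y0 ix; rewrite mem_enum inE.
have [phi phiE] : exists phi : V -> W, forall x,
    (g (phi x) == f x) && (index (phi x) (ew (f x)) == index x (ev (f x))).
  by exists (fun x => xchoose (phiP x)) => x; apply: (xchooseP (phiP x)).
have gphi x : g (phi x) = f x by have /andP[/eqP] := phiE x.
exists phi => //; apply: inj_card_bij.
  move=> x y exy; have fxy : f x = f y by rewrite -!gphi exy.
  have /andP[_ /eqP ix] := phiE x; have /andP[_ /eqP iy] := phiE y.
  have := in_v y; rewrite -fxy => y_in.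
  rewrite -(nth_index x (in_v x)) -(nth_index x y_in) -ix.
  by rewrite exy fxy iy.
have cardS (T : finType) (k : T -> L) (s : seq L) : uniq s ->
    (forall x, k x \in s) -> #|T| = \sum_(l <- s) #|[set x | k x == l]|.
  move=> us ks; rewrite -sum1_card.
  rewrite (eq_bigr (fun x => \sum_(l <- s) (k x == l : nat))); last first.
    move=> x _; rewrite (bigD1_seq (k x)) //= eqxx big1 // => l.
    by rewrite eq_sym => /negPf->.
  rewrite exchange_big; apply: eq_bigr => l _.
  by rewrite -sum1dep_card [RHS]big_mkcond /=; apply: eq_bigr => x _; case: eqP.
pose s := undup ([seq f x | x <- enum V] ++ [seq g y | y <- enum W]).
rewrite (cardS V f s) ?undup_uniq //; last first.
  by move=> x; rewrite mem_undup mem_cat map_f ?mem_enum.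
rewrite (cardS W g s) ?undup_uniq //; last first.
  by move=> x; rewrite mem_undup mem_cat orbC map_f ?mem_enum.
by apply: leq_sum => l _; rewrite eqN.
Qed.

(* The flags of a vertex record whether it is on the first spine [al] or on the
   second one [be]. *)
Definition spine_label (V : eqType) (lev : V -> nat) (al be : nat -> V) (x : V) :=
  (lev x, (0 < lev x) && (x == al (lev x)), (0 < lev x) && (x == be (lev x))).

(* [p] may be attached to [q] from above: below level 1, the second spine only
   continues itself, and everything else hangs from the first one. *)
Definition spine_up (e : bool) (p q : nat * bool * bool) : bool :=
  let: (i, pa, pb) := p in let: (j, qa, qb) := q in
  (i == j.+1) && ((j == 0) || (if pb then qb else qa)) ||
  [&& ~~ e, i == 1, j == 1, pa & qb].

Record spine (G : sgraph) (e : bool) (h : nat) (lev : G -> nat) (al be : nat -> G) :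
    Prop := Spine {
  sp_le : forall x, lev x <= h;
  sp_al : forall k, 0 < k <= h -> lev (al k) = k;
  sp_be : forall k, 0 < k <= h -> lev (be k) = k;
  sp_neq : forall k, 0 < k <= h -> al k != be k;
  sp_adj : forall x y,
    let lab := spine_label lev al be in
    adj x y = spine_up e (lab x) (lab y) || spine_up e (lab y) (lab x) }.

Lemma spine_label_card (G : sgraph) e h (lev : G -> nat) al be k pa pb :
  spine e h lev al be ->
  #|[set x | spine_label lev al be x == (k, pa, pb)]| =
  if 0 < k <= h then
    if pa && pb then 0 else
    if pa || pb then 1 else #|[set x | lev x == k]| - 2
  else if pa || pb then 0 else #|[set x | lev x == k]|.
Proof.
move=> S; case: ifP => kh; last first.
  case: ifP => pab.
    apply: eq_card0 => x; rewrite !inE /spine_label !xpair_eqE.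
    apply/negP => /andP[/andP[/eqP xk]]; have := sp_le S x; rewrite xk => kle.
    have -> : k = 0 by case: (k) kh kle => // n /= ->.
    by move=> /eqP pa0 /eqP pb0; rewrite -pa0 -pb0 in pab.
  apply: eq_card => x; rewrite !inE /spine_label !xpair_eqE.
  case: (lev x =P k) => //= xk; have := sp_le S x; rewrite xk => kle.
  have -> : k = 0 by case: (k) kh kle => // n /= ->.
  by case: pa pab; case: pb.
have [k0 _] := andP kh; have ak := sp_al S kh; have bk := sp_be S kh.
have ab := sp_neq S kh.
have flag x : spine_label lev al be x == (k, pa, pb) =
    [&& lev x == k, (x == al k) == pa & (x == be k) == pb].
  by rewrite /spine_label !xpair_eqE -andbA; case: eqP => //= ->; rewrite k0.
have -> : #|[set x | spine_label lev al be x == (k, pa, pb)]| =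
  #|[set x | [&& lev x == k, (x == al k) == pa & (x == be k) == pb]]|.
  by apply: eq_card => x; rewrite !inE flag.
case: pa pb {flag} => -[] /=.
- apply: eq_card0 => x; rewrite !inE !eqb_id; apply/negP => /and3P[_ /eqP-> ].
  by rewrite (negPf ab).
- rewrite -(cards1 (al k)); apply: eq_card => x; rewrite !inE eqb_id eqbF_neg.
  by case: (x =P al k) => [->|_]; rewrite ?andbF // ak eqxx /= ab.
- rewrite -(cards1 (be k)); apply: eq_card => x; rewrite !inE eqb_id eqbF_neg.
  by case: (x =P be k) => [->|_]; rewrite ?andbF // bk eqxx /= eq_sym ab.
rewrite -(@card_rest _ [set x | lev x == k] (al k) (be k)); last 3 first.
- by rewrite inE ak.
- by rewrite inE bk.
- exact: ab.
by apply: eq_card => x; rewrite !inE !eqbF_neg andbC -andbA andbCA.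
Qed.

(** Label frequencies depend only on the level sizes and adjacency only on the labels, so any
    label-preserving bijection will do. *)
Lemma spine_isomorphic (G H : sgraph) e h
    (lev : G -> nat) al be (lev' : H -> nat) al' be' :
  spine e h lev al be -> spine e h lev' al' be' ->
  (forall k, #|[set x | lev x == k]| = #|[set y | lev' y == k]|) ->
  isomorphic G H.
Proof.
move=> S S' eqN.
have [|phi bij_phi lab_phi] := @label_bijection G H _
   (spine_label lev al be) (spine_label lev' al' be').
  by move=> [[k pa] pb]; rewrite (spine_label_card _ _ _ S) (spine_label_card _ _ _ S') eqN.
by exists phi => // x y; rewrite (sp_adj S') (sp_adj S); cbv zeta; rewrite !lab_phi.
Qed.

(** * From spines to tightness and from rigidity to spines *)

Section SpineBranched.
Variables (G : sgraph) (c : G) (par : G -> G) (dp : G -> nat).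
Variables (e : bool) (h : nat) (r a b : G).
Hypothesis BG : branched c par dp e h r a b.
Implicit Types (x y u v w : G).
Local Notation lev := (level par dp e r).
Local Notation L := (lset par dp e r).
Local Notation s := (side_size c par r).
Local Notation f := (side_count c par r).
Let RG := br_rooted BG.

Lemma adj_side_child v w : adj w v -> 0 < lev v -> lev w = (lev v).+1 ->
  side_child c par r v w.
Proof.
move=> wv v0 wE; have [wc wr] := level_gt1 BG (ltac:(by rewrite wE) : 1 < lev w).
move: wv; rewrite (adj_par RG) => /andP[_ /orP[pw|/eqP pv]]; first by rewrite /side_child wc wr.
have [vc|vc] := eqVneq v c; first by move: wE; rewrite -pv vc (par_root RG); lia.
have [vr|vr] := eqVneq v r.
  by move: wc; rewrite -pv vr (br_par BG) eqxx.
by have := level_par BG vc vr; rewrite pv wE; lia.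
Qed.

Lemma side_child_adj v w : side_child c par r v w -> adj w v /\ lev w = (lev v).+1.
Proof.
case/and3P => wc wr /eqP pw; rewrite (level_par BG wc wr) pw; split=> //.
by rewrite -pw (adj_par_self RG).
Qed.

(** The only child of [be k] is [be k.+1], so both weights on this spine count the remaining levels;
    off the spines there are no children. *)
Lemma spine_tight al be : spine e h lev al be -> tight c par dp e h r al be.
Proof.
move=> S k kh.
have in_a j : 0 < j <= h -> al j \in L j by move=> jh; rewrite mem_lset (sp_al S jh).
have in_b j : 0 < j <= h -> be j \in L j by move=> jh; rewrite mem_lset (sp_be S jh).
have child j v w : 0 < j <= h -> lev v = j -> side_child c par r v w ->
    [/\ lev w = j.+1, j < h & if w == be j.+1 then v == be j else v == al j].
  move=> jh vj vw; have [wv wE] := side_child_adj vw; have := sp_le S w.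
  rewrite wE vj => jlt; split=> //; have [j0 _] := andP jh.
  move: wv; rewrite (sp_adj S) /spine_label /= wE vj j0 /= eqxx (gtn_eqF j0) /=.
  have -> : (j.+1 == 1) = false by rewrite eqSS gtn_eqF.
  rewrite !andbF !orbF (_ : (j == j.+2) = false) /= ?orbF //.
  by apply/eqP; lia.
have be_child j : 0 < j -> j < h ->
    side_child c par r (be j) =1 pred1 (be j.+1).
  move=> j0 jh w; have jh' : 0 < j <= h by rewrite j0 ltnW.
  have bj := sp_be S jh'; apply/idP/eqP.
    case/(child j _ _ jh' bj) => wj _; case: eqP => // _ /eqP ab.
    by have := sp_neq S jh'; rewrite ab eqxx.
  move=> ->; have bj1 : lev (be j.+1) = j.+1 by apply: sp_be S _ _.
    apply: adj_side_child.
  - rewrite (sp_adj S) /spine_label /= bj bj1 /= j0 !eqxx /=.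
    by rewrite orbT.
  - by rewrite bj.
  - by rewrite bj bj1.
split; [exact: in_a|exact: in_b|exact: (sp_neq S)| |].
  move: kh => /andP[k0 kh]; rewrite -(subKn kh) in k0 *; move: (h - k) k0 => i.
  elim: i {k kh} => [|i IHi] ih.
    rewrite subn0 in ih *; rewrite subnn (side_sizeE BG) (side_countE BG).
    have hh : 0 < h <= h by rewrite ih leqnn.
    have no w : side_child c par r (be h) w = false.
      by apply/negP => /(child h _ _ hh (sp_be S hh))[_]; rewrite ltnn.
    by rewrite !big_pred0.
  have [|IH1 IH2] := IHi; first by lia.
  have ki : h - i.+1 < h by lia.
  rewrite (side_sizeE BG) (side_countE BG) !(eq_bigl _ _ (be_child _ ih ki)) !big_pred1_eq.
  by rewrite subnSK ?IH1 ?IH2; lia.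
move=> v; rewrite mem_lset => /eqP vk va vb.
have no w : side_child c par r v w = false.
  apply/negP => /(child k v w kh vk)[_ _].
  by rewrite (negPf va) (negPf vb) if_same.
by rewrite (side_sizeE BG) (side_countE BG) !big_pred0.
Qed.

(** Only parents of vertices below level 1 have to be prescribed. Above that, adjacency is forced:
    level 1 is either the set of children of [c] or the pair [c], [r], which is then [al 1], [be 1]
    in some order. *)
Lemma branched_spine al be :
  (forall k, 0 < k <= h -> lev (al k) = k) ->
  (forall k, 0 < k <= h -> lev (be k) = k) ->
  (forall k, 0 < k <= h -> al k != be k) ->
  (forall k w, 0 < k -> lev w = k.+1 ->
     par w = if w == be k.+1 then be k else al k) ->
  spine e h lev al be.
Proof.
move=> lev_al lev_be albe parE.
have odd1 x : ~~ e -> lev x = 1 -> x = al 1 \/ x = be 1.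
  move=> e0 x1; have h0 := height_gt0 BG.
  have mem1 y : lev y = 1 -> y \in [set c; r] by rewrite -(lset1_odd BG) // mem_lset => ->.
  have := mem1 x x1; have := mem1 _ (lev_al 1 h0); have := mem1 _ (lev_be 1 h0).
  have := albe 1 h0; rewrite !inE.
  by move=> ab /orP[]/eqP bE /orP[]/eqP aE /orP[]/eqP ->; rewrite ?aE ?bE; auto;
    rewrite aE bE eqxx in ab.
split=> //; first exact: (br_level_le BG).
have up x : x != c -> spine_up e (spine_label lev al be x) (spine_label lev al be (par x))
   || spine_up e (spine_label lev al be (par x)) (spine_label lev al be x).
  move=> xc; have h0 := height_gt0 BG; rewrite /spine_label /=.
  have [->|xr] := eqVneq x r.
    rewrite (br_par BG) (level_branch BG) (level_root BG).
    have [e1|e0] := boolP e; first by [].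
    have lr := level_branch BG; have lc := level_root BG; rewrite e0 in lc.
    by case: (odd1 c e0 lc) (odd1 r e0 lr) => cE [] rE;
      rewrite /= ?cE ?rE ?eqxx ?andbT ?orbT //; have := br_neq BG; rewrite rE cE eqxx.
  rewrite (level_par BG xc xr) !eqxx /=.
  case: (posnP (lev (par x))) => [->//|p0] /=.
  have := parE _ x p0 (level_par BG xc xr); case: ifP => _ <-; by rewrite eqxx.
have down x y : spine_up e (spine_label lev al be x) (spine_label lev al be y) -> adj x y.
  rewrite /spine_up /spine_label => /orP[/andP[/eqP xy]|/and5P[e0 /eqP x1 /eqP y1]].
    case: (posnP (lev y)) => [y0 _|y0 /=].
      have [e1 yc] := level0 BG y0; rewrite y0 in xy.
      have : x \in L 1 by rewrite mem_lset xy.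
      rewrite (lset1_even BG) // inE => /andP[xc /eqP px].
      by rewrite yc -px (adj_par_self RG).
    rewrite xy /= => h1; have px := parE _ x y0 xy.
    have [xc _] := level_gt1 BG (ltac:(by rewrite xy) : 1 < lev x).
    have -> : y = par x by rewrite px; case: ifP h1 => _ /eqP.
    exact: (adj_par_self RG).
  rewrite x1 y1 /= => /eqP xa /eqP yb.
  have mem1 u : lev u = 1 -> u \in [set c; r] by rewrite -(lset1_odd BG) // mem_lset => ->.
  have xNy : x != y by rewrite xa yb albe // (height_gt0 BG).
  have rc : adj r c by rewrite -(br_par BG) (adj_par_self RG) // (br_neq BG).
  have := mem1 x x1; have := mem1 y y1; rewrite !inE.
  move=> /orP[]/eqP yE /orP[]/eqP xE; move: xNy; rewrite xE yE ?eqxx // => _.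
  by rewrite adj_sym.
move=> x y /=; apply/idP/orP => [|[/down//|/down]]; last by rewrite adj_sym.
rewrite (adj_par RG) => /andP[xy /orP[]/eqP pE].
  apply/orP; rewrite -pE up //; apply: contraNneq xy => xc.
  by rewrite -pE xc (par_root RG).
apply/orP; rewrite orbC -pE up //; apply: contraNneq xy => yc.
by rewrite -pE yc (par_root RG).
Qed.

(** The second spine is the chain whose level 1 vertex has the least possible size [h]; the other
    chain is the first spine. *)
Lemma rigid_spine : rigid c par dp e h r a b ->
  exists al be, spine e h lev al be.
Proof.
case=> leaf narrow.
have ha := br_level_a BG; have hb := br_level_b BG.
have [z [z' [zh zh' zz' zP]]] : exists z z', [/\ lev z = h, lev z' = h,
    (forall k, 0 < k <= h -> chain par h z k != chain par h z' k) &
    (1 < h -> s (chain par h z' 1) = h) /\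
    (forall k v, 0 < k < h -> v \in L k -> v != chain par h z k ->
       v != chain par h z' k -> s v = 1)].
  have [h1|h1] := ltnP 1 h; last first.
    by exists a, b; split=> //; exact: (chain_neq BG).
  have [sa|sb] := narrow h1; [exists b, a|exists a, b]; split=> //.
  - by move=> k kh; rewrite eq_sym (chain_neq BG).
  - by split=> [_|k v kh vL vb va]; [exact: sa|exact: leaf kh vL va vb].
  - exact: (chain_neq BG).
case: zP => z1 {}leaf; pose al := chain par h z; pose be := chain par h z'.
have lev_al k : 0 < k <= h -> lev (al k) = k by case/(chain_level BG zh).
have lev_be k : 0 < k <= h -> lev (be k) = k by case/(chain_level BG zh').
(* Minimality at level 1 passes down the chain, because each vertex is larger than the next one and
   the latter has its own lower bound. *)
have narrow_be k : 0 < k -> k < h -> s (be k) = (h - k).+1.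
  elim: k => // -[|k] IHk _ kh; first by rewrite z1 // subn1 prednK // ltnW.
  have k1h : k.+1 < h by lia.
  have := IHk isT k1h; have ch := chain_child BG zh' (isT : 0 < k.+1) k1h.
  rewrite (side_sizeE BG) (bigD1 _ ch) /= -/(be k.+2).
  by have := chain_size BG zh' (k := k.+2); rewrite -/(be k.+2); lia.
have be_uniq k w : 0 < k -> k < h -> side_child c par r (be k) w -> w = be k.+1.
  move=> k0 kh bw; apply/eqP/negPn/negP => wN.
  have := narrow_be k k0 kh; have ch := chain_child BG zh' k0 kh.
  rewrite (side_sizeE BG) (bigD1 _ ch) /= (bigD1 w) /= ?bw //.
  have := chain_size BG zh' (k := k.+1); have := side_size_gt0 BG w.
  by rewrite -/(be k.+1); lia.
have parE k w : 0 < k -> lev w = k.+1 -> par w = if w == be k.+1 then be k else al k.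
  move=> k0 wk; have kh : k < h by rewrite -wk (br_level_le BG).
  case: eqP => [->|wN]; first by rewrite -chain_step.
  have [wc wr] := level_gt1 BG (ltac:(by rewrite wk) : 1 < lev w).
  have cw : side_child c par r (par w) w by rewrite /side_child wc wr /=.
  have pk : par w \in L k by rewrite mem_lset -eqSS -(level_par BG) ?wk.
  (* The parent of [w] has size at least 2, so it is on one of the chains; and [be k] has no child
     other than [be k.+1]. *)
  apply/eqP/negPn/negP => pal; have [pb|pbe] := eqVneq (par w) (be k).
    by move: cw; rewrite pb => /(be_uniq k w k0 kh).
  have := leaf k (par w) _ pk pal pbe; rewrite k0 kh => /(_ isT).
  by rewrite (side_sizeE BG) (bigD1 w) //=; have := side_size_gt0 BG w; lia.
exists al, be; exact: branched_spine.
Qed.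

End SpineBranched.

(** * The caterpillar *)

(** Both predicates fail at the root and obey the same recursion along parents. *)
Lemma below_char (G : sgraph) (c : G) par dp (r : G) (P : pred G) :
  rooted c par dp -> r != c -> ~~ P c ->
  (forall x, x != c -> P x = (x == r) || P (par x)) ->
  forall x, below par r x = P x.
Proof.
move=> RG rc Pc PE x; move: {2}(dp x) (erefl (dp x)) => n.
elim: n x => [|n IHn] x dx; have [xc|xc] := eqVneq x c.
- rewrite xc (negPf Pc); apply/negP => /(below_dp_le RG).
  by rewrite (dp_root RG) leqNgt (dp_gt0 RG) rc.
- by move: xc; rewrite -(dp_eq0 RG) dx.
- by move: dx; rewrite xc (dp_root RG).
by rewrite belowE PE // IHn // (dp_par_le RG) dx.
Qed.

Section CaterpillarLevels.
Variables (e : bool) (h q : nat) (t : nat -> nat).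
Hypotheses (h0 : 0 < h) (qE : q.+1 = h - ~~ e + h).
Let C := caterpillar q t.
Local Notation ctr := (h - ~~ e).

(** The path has [ctr + h] edges, so the root is [v_ctr] and [r] is the next path vertex. The
    pendant vertices sit at [v_1, ..., v_ctr], that is, at the root and on the side of [v_0]. *)
Lemma uphalf_ctr : uphalf q = ctr.
Proof. by move: qE h0; case: (e) => /=; lia. Qed.

Definition path_vertex (i : nat) : C := inl (inord i).

Lemma path_vertex_eq i j : i < q.+2 -> j < q.+2 -> (path_vertex i == path_vertex j) = (i == j).
Proof.
move=> iq jq; apply/eqP/eqP => [[/(congr1 val)]|->//].
by rewrite /= !inordK.
Qed.

Definition toward (i : nat) := if i < ctr then i.+1 else if i == ctr then i else i.-1.

Definition cat_par (x : C) : C :=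
  match x with
  | inl i => path_vertex (toward i)
  | inr p => path_vertex (tag p).+1
  end.

Definition cat_depth (x : C) : nat :=
  match x with inl i => (i - ctr) + (ctr - i) | inr p => ctr - tag p end.

Lemma ctr_lt : ctr < q.+2.
Proof. by rewrite qE; lia. Qed.

Lemma tag_lt (p : {j : 'I_(uphalf q) & 'I_(t j.+1)}) : tag p < ctr.
Proof. by rewrite -uphalf_ctr. Qed.

Lemma toward_lt i : i < q.+2 -> toward i < q.+2.
Proof. by have := ctr_lt; rewrite /toward; case: ifP; [|case: ifP]; lia. Qed.

Lemma path_vertex_inl (i : 'I_q.+2) : inl i = path_vertex i.
Proof. by rewrite /path_vertex inord_val. Qed.

Lemma cat_par_path i : i < q.+2 -> cat_par (path_vertex i) = path_vertex (toward i).
Proof. by move=> iq; rewrite /= inordK. Qed.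

Lemma cat_depth_path i : i < q.+2 -> cat_depth (path_vertex i) = (i - ctr) + (ctr - i).
Proof. by move=> iq; rewrite /= inordK. Qed.

Lemma cat_rooted : rooted (path_vertex ctr) cat_par cat_depth.
Proof.
have cq := ctr_lt; split.
- by rewrite cat_par_path // /toward ltnn eqxx.
- by rewrite cat_depth_path // subnn.
- move=> [i|p] xc; last first.
    have := tag_lt p; rewrite [cat_par _]/= cat_depth_path /=; last by have := tag_lt p; lia.
    by lia.
  rewrite path_vertex_inl in xc *; have iq := ltn_ord i.
  rewrite cat_par_path // !cat_depth_path ?toward_lt //.
  by rewrite path_vertex_eq // in xc; rewrite /toward; case: ifP; [|case: ifP]; lia.
- move=> [i|p] [k|p'] /=.
  + rewrite !path_vertex_inl.
    have iq := ltn_ord i; have kq := ltn_ord k.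
    rewrite !path_vertex_eq ?toward_lt // /toward.
    by do 2 (case: ifP => ?; [|case: ifP => ?]); lia.
  + rewrite !path_vertex_inl; have iq := ltn_ord i; have pq := tag_lt p'.
    by rewrite path_vertex_eq 1?eq_sym // qE; lia.
  + rewrite !path_vertex_inl; have kq := ltn_ord k; have pq := tag_lt p.
    have -> : (path_vertex (toward k) == inr p) = false by [].
    by rewrite orbF path_vertex_eq 1?eq_sym // qE; lia.
  + by rewrite andbF.
Qed.

Definition cat_far (x : C) : bool := if x is inl i then ctr < i else false.

Lemma cat_below x : below cat_par (path_vertex ctr.+1) x = cat_far x.
Proof.
have cq : ctr.+1 < q.+2 by rewrite qE; lia.
apply: (below_char cat_rooted).
- by rewrite path_vertex_eq ?ctr_lt //; lia.
- by rewrite /= inordK ?ctr_lt // ltnn.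
- move=> [i|p] xc; last first.
    by rewrite /= inordK; have := tag_lt p; lia.
  rewrite path_vertex_inl in xc *; have iq := ltn_ord i; rewrite path_vertex_eq ?ctr_lt // in xc.
  rewrite path_vertex_eq // cat_par_path // /cat_far /= !inordK ?toward_lt //.
  by rewrite /toward; case: ifP; [|case: ifP]; lia.
Qed.

Local Notation clev := (level cat_par cat_depth e (path_vertex ctr.+1)).
Local Notation CL := (lset cat_par cat_depth e (path_vertex ctr.+1)).

Lemma cat_level_path i : i < q.+2 ->
  clev (path_vertex i) = if ctr < i then i - ctr else h - i.
Proof.
move=> iq; rewrite /level cat_below cat_depth_path // /cat_far /= inordK //.
by case: ltnP; case: (e) => /=; lia.
Qed.

Lemma cat_level_pendant p : clev (inr p) = h - tag p.
Proof.
by rewrite /level cat_below /=; have := tag_lt p; case: (e) => /=; lia.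
Qed.

Lemma cat_branched :
  branched (path_vertex ctr) cat_par cat_depth e h (path_vertex ctr.+1)
    (path_vertex 0) (path_vertex q.+1).
Proof.
have cq : ctr.+1 < q.+2 by rewrite qE; lia.
split.
- exact: cat_rooted.
- by rewrite path_vertex_eq ?ctr_lt //; lia.
- by rewrite cat_par_path // /toward ltnNge leqnSn /= gtn_eqF.
- move=> [i|p]; last by rewrite cat_level_pendant leq_subr.
  rewrite path_vertex_inl cat_level_path //; have iq := ltn_ord i; move: qE.
  by case: ltnP; move: (h - _) => k; lia.
- by rewrite cat_below /= inordK.
- by rewrite cat_below /= inordK // qE; lia.
- by rewrite cat_level_path // ltn0 subn0.
- by rewrite cat_level_path // qE; case: ifP; lia.
Qed.

(** The first spine ends at [v_0] and carries pendant vertices; the second one, [cat_be], is the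
    bare half of the path. *)
Definition cat_al k := path_vertex (h - k).
Definition cat_be k := path_vertex (ctr + k).

Lemma cat_spine : spine e h clev cat_al cat_be.
Proof.
have aq k : h - k < q.+2 by rewrite qE; case: (e) => /=; lia.
have bq k : k <= h -> ctr + k < q.+2 by rewrite qE; lia.
apply: (branched_spine cat_branched).
- move=> k /andP[k0 kh]; rewrite cat_level_path //.
  by case: ltnP; case: (e) => /=; lia.
- move=> k /andP[k0 kh]; rewrite cat_level_path ?bq //.
  by case: ltnP; lia.
- move=> k /andP[k0 kh]; rewrite path_vertex_eq ?bq //.
  by case: (e) => /=; lia.
move=> k [i|p] k0; last first.
  (* A pendant vertex with tag [j] hangs from [v_{j+1}]; being on level [k + 1] means
     [j + 1 = h - k]. *)
  rewrite cat_level_pendant /= => pk; rewrite /cat_al.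
  by congr path_vertex; move: pk; lia.
rewrite path_vertex_inl; have iq := ltn_ord i; rewrite cat_level_path // cat_par_path //.
have kh : ctr < i -> i - ctr <= h by move: qE iq; lia.
case: ltnP => ci ik.
  have -> : nat_of_ord i = ctr + k.+1 by lia.
  rewrite eqxx /toward; do 2 (case: ifP => [|_]; first by lia).
  by rewrite /cat_be addnS.
rewrite path_vertex_eq //; last by apply: bq; lia.
case: eqP => [|_]; first by lia.
rewrite /cat_al /toward; have -> : i < ctr by move: ik ci; case: (e) => /=; lia.
by have -> : i.+1 = h - k by lia.
Qed.

(** Besides the two spine vertices, level [k] contains exactly the pendant vertices with tag
    [h - k]. For odd diameter the second hypothesis excludes level 1. *)
Lemma cat_card k : 0 < k <= h -> h - k < ctr -> #|CL k| = (t (h - k).+1).+2.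
Proof.
move=> kh kc; have S := cat_spine.
have ak := sp_al S kh; have bk := sp_be S kh; have ab := sp_neq S kh.
have aL : cat_al k \in CL k by rewrite mem_lset ak.
have bL : cat_be k \in CL k by rewrite mem_lset bk.
rewrite (cardsD1 (cat_al k)) aL (cardsD1 (cat_be k)) !in_setD1 bL eq_sym ab !add1n.
congr _.+2; rewrite -uphalf_ctr in kc.
pose j := Ordinal kc.
pose g (s : 'I_(t j.+1)) : C := inr (Tagged (fun j : 'I_(uphalf q) => 'I_(t j.+1)) s).
have g_inj : injective g.
  by move=> s s' [] /eqP; rewrite -tag_eqE /tag_eq eqxx /= tagged_asE => /eqP.
rewrite -[RHS]card_ord -(card_imset _ g_inj); apply: eq_card => x.
rewrite !in_setD1 mem_lset; apply/and3P/imsetP => [[xb xa]|[s _ ->]]; last first.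
  by rewrite cat_level_pendant /=; split=> //; apply/eqP; rewrite subKn //; case/andP: kh.
case: x xa xb => [i|p].
  rewrite path_vertex_inl; have iq := ltn_ord i; have [k0 kh'] := andP kh.
  rewrite !path_vertex_eq //.
  - rewrite cat_level_path // => ia ib /eqP; case: ltnP => ci ik.
      by case/eqP: ib; lia.
    by case/eqP: ia; lia.
  - by rewrite qE; lia.
  - by rewrite qE; case: (e) => /=; lia.
move=> _ _; rewrite cat_level_pendant => /eqP pk.
case: p pk => j' s pk; have jE : j' = j.
  have jc : j' < ctr by rewrite -uphalf_ctr.
  by apply: val_inj => /=; move: pk => /=; lia.
by rewrite jE in s pk *; exists s.
Qed.

End CaterpillarLevels.

(** * Eccentric sequences *)

Lemma count_ecc_seq (G : sgraph) v :
  count_mem v (ecc_seq G) = #|[set x : G | ecc x == v]|.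
Proof.
rewrite /ecc_seq (permP (permEl (perm_sort _ _))) count_map cardE.
rewrite -size_filter /enum_mem; congr size; rewrite -filter_predI.
by apply: eq_filter => x; rewrite /= !inE andbT.
Qed.

Lemma ecc_seq_eq (G H : sgraph) :
  (forall v, #|[set x : G | ecc x == v]| = #|[set x : H | ecc x == v]|) ->
  ecc_seq G = ecc_seq H.
Proof.
move=> eqN; apply: (sorted_eq leq_trans anti_leq).
- exact: (sort_sorted leq_total).
- exact: (sort_sorted leq_total).
- by apply/allP => v _; rewrite /= !count_ecc_seq eqN.
Qed.

Lemma size_ecc_seq (G : sgraph) : size (ecc_seq G) = #|G|.
Proof. by rewrite size_sort size_map -cardE. Qed.

Lemma count_mult_seq l b m v :
  count_mem v (mult_seq l b m) = \sum_(i <- iota 1 l) (b i == v) * m i.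
Proof.
rewrite /mult_seq; elim: (iota 1 l) => [|i s IHs]; first by rewrite big_nil.
by rewrite /= count_cat IHs big_cons count_nseq.
Qed.

Lemma size_mult_seq l b m : size (mult_seq l b m) = \sum_(1 <= i < l.+1) m i.
Proof.
rewrite /mult_seq /index_iota subn1 /=.
elim: (iota 1 l) => [|i s IHs]; first by rewrite big_nil.
by rewrite /= size_cat IHs big_cons size_nseq.
Qed.

Lemma mult_seq_mult l b m i : mult_form l b m -> 0 < i <= l ->
  count_mem (b i) (mult_seq l b m) = m i.
Proof.
case=> b_lt m_gt /andP[i0 il]; rewrite count_mult_seq.
have i_in : i \in iota 1 l by rewrite mem_iota i0 add1n ltnS.
rewrite (bigD1_seq i i_in (iota_uniq 1 l)) /=.
rewrite eqxx mul1n big_seq_cond big1 ?addn0 // => j.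
rewrite mem_iota => /andP[/andP[j1 jl] ji].
case: eqP => // bj; case: (ltngtP i j) => ij.
- have jl' : j <= l by lia.
  by have := b_lt i j i0 ij jl'; lia.
- by have := b_lt j i j1 ij il; lia.
- by rewrite ij eqxx in ji.
Qed.

Lemma mem_mult_seq l b m v : mult_form l b m ->
  (v \in mult_seq l b m) = (v \in [seq b i | i <- iota 1 l]).
Proof.
case=> b_lt m_gt; apply/flattenP/mapP => [[s /mapP[i il ->]]|[i il ->]].
  by rewrite mem_nseq => /andP[_ /eqP->]; exists i.
exists (nseq (m i) (b i)); first by apply/mapP; exists i.
rewrite mem_nseq eqxx andbT; apply: m_gt; move: il; rewrite mem_iota.
by case/andP => ? ?; lia.
Qed.

(** * Reading the multiplicities as level sizes *)

Section Sequence.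
Variables (l : nat) (b m : nat -> nat).
Hypothesis mf : mult_form l b m.
Variables (T : sgraph) (c : T) (par : T -> T) (dp : T -> nat).
Variables (e : bool) (h : nat) (r x y : T).
Hypothesis BT : branched c par dp e h r x y.
Hypothesis seqT : ecc_seq T = mult_seq l b m.
Local Notation ctr := (h - ~~ e).
Local Notation L := (lset par dp e r).

Lemma card_ecc (v : nat) :
  #|[set z : T | ecc z == v + ctr]| = #|L v|.
Proof.
by apply: eq_card => z; rewrite !inE (branched_ecc BT) eqn_add2r.
Qed.

Lemma card_lset0 : #|L 0| = e.
Proof.
case/orP: (orbN e) => [e1|e0]; last first.
  transitivity 0; last by rewrite (negPf e0).
  apply: eq_card0 => z; rewrite mem_lset; apply/eqP => z0.
  by have [e1 _] := level0 BT z0; rewrite e1 in e0.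
transitivity 1; last by rewrite e1.
rewrite -[RHS](cards1 c); apply: eq_card => z; rewrite mem_lset inE.
apply/eqP/eqP => [z0|->]; last by rewrite (level_root BT) e1.
by have [_ ->] := level0 BT z0.
Qed.

Lemma card_lset_above k : h < k -> #|L k| = 0.
Proof.
move=> hk; apply: eq_card0 => z; rewrite mem_lset; apply/eqP => zk.
by have := br_level_le BT z; rewrite zk leqNgt hk.
Qed.

Lemma card_lset1_odd : ~~ e -> #|L 1| = 2.
Proof. by move=> e0; rewrite (lset1_odd BT) // cards2 eq_sym (br_neq BT). Qed.

Lemma card_lset_gt1 k : 0 < k <= h -> 1 < #|L k|.
Proof.
move=> kh; apply/card_gt1P; exists (chain par h x k), (chain par h y k).
have [lx _] := chain_level BT (br_level_a BT) kh.
have [ly _] := chain_level BT (br_level_b BT) kh.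
by rewrite !mem_lset lx ly (chain_neq BT).
Qed.

Lemma level_nonempty k : k <= h -> (0 < #|L k|) = (~~ e <= k).
Proof.
move=> kh; case: (posnP k) => [->|k0].
  rewrite leqn0 eqb0 negbK; apply/card_gt0P/idP => [[z]|e1].
    by rewrite mem_lset => /eqP/(level0 BT)[].
  by exists c; rewrite mem_lset (level_root BT) e1.
have -> : (~~ e <= k) = true by case: (e) k0.
apply/card_gt0P; exists (chain par h x k).
have [|xk _] := chain_level BT (br_level_a BT) (k := k); first by rewrite k0.
by rewrite mem_lset xk.
Qed.

(** Every level from [~~ e] to [h] is occupied, so the eccentricities fill an interval that starts
    at the radius. Strictly increasing lists with the same members are equal. *)
Lemma ecc_values : [seq b i | i <- iota 1 l] = iota h ctr.+1.
Proof.
have h0 := height_gt0 BT.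
apply: (irr_sorted_eq (leT := ltn) ltn_trans ltnn).
- case: mf => b_lt _; rewrite sorted_map.
  apply/(sortedP 0) => i; rewrite size_iota => i_n.
  by rewrite /= !nth_iota; try lia; apply: b_lt; lia.
- exact: iota_ltn_sorted.
move=> v; rewrite -(mem_mult_seq v mf) -seqT -has_pred1 has_count count_ecc_seq mem_iota.
have [hv|hv] := leqP h v; last first.
  apply/card_gt0P => -[z]; rewrite inE (branched_ecc BT) => /eqP zv.
  have : ~~ e <= level par dp e r z.
    rewrite -level_nonempty ?(br_level_le BT) //.
    by apply/card_gt0P; exists z; rewrite mem_lset.
  by lia.
have -> : v = (v - ctr) + ctr by lia.
rewrite card_ecc; have [vh|vh] := leqP (v - ctr) h; last first.
  rewrite (_ : L _ = set0) ?cards0; first by apply/esym/negbTE; lia.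
  by apply/setP => z; rewrite mem_lset inE; apply/eqP => zv; have := br_level_le BT z; lia.
by rewrite level_nonempty //; apply/idP/idP; lia.
Qed.

Lemma seq_length : l = ctr.+1.
Proof. by have := congr1 size ecc_values; rewrite size_map !size_iota. Qed.

Lemma seq_value i : 0 < i <= l -> b i = h + i.-1.
Proof.
move=> il; have := congr1 (fun s => nth 0 s i.-1) ecc_values.
rewrite (nth_map 0) ?size_iota; last by lia.
rewrite !nth_iota; first by rewrite add1n prednK //; case/andP: il.
- by rewrite -seq_length; lia.
- by lia.
Qed.

Lemma seq_mult i : 0 < i <= l -> m i = #|L (~~ e + i.-1)|.
Proof.
move=> il; rewrite -(mult_seq_mult mf il) -seqT count_ecc_seq -card_ecc seq_value //.
have h0 := height_gt0 BT.
by apply: eq_card => z; rewrite !inE; congr (_ == _); case: (e) => /=; lia.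
Qed.
End Sequence.

(** Eccentricities are levels up to a common shift, so it is enough that the caterpillar and the
    given tree have the same level sizes. *)
Lemma ecc_caterpillar_branched l b m T c par dp e h r x y :
  mult_form l b m -> @branched T c par dp e h r x y ->
  ecc_seq T = mult_seq l b m ->
  let C := ecc_caterpillar l b m in
  tree_with (mult_seq l b m) C /\
  exists c' par' dp' r' x' y' al be,
    [/\ @branched C c' par' dp' e h r' x' y',
        spine e h (level par' dp' e r') al be &
        forall k, #|lset par dp e r k| = #|lset par' dp' e r' k| ].
Proof.
move=> mf BT seqT C; have h0 := height_gt0 BT.
have lE := seq_length mf BT seqT; have bE := seq_value mf BT seqT.
have mE := seq_mult mf BT seqT.
have qE : (b l - 1).+1 = h - ~~ e + h.
  by rewrite bE; lia.
have BC := cat_branched (fun j => m (l + 1 - j) - 2) h0 qE.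
have SC := cat_spine (fun j => m (l + 1 - j) - 2) h0 qE.
have cardL k : #|lset par dp e r k| =
    #|lset (@cat_par e h (b l - 1) (fun j => m (l + 1 - j) - 2))
        (@cat_depth e h (b l - 1) (fun j => m (l + 1 - j) - 2)) e
        (path_vertex (b l - 1) _ (h - ~~ e).+1) k|.
  have [kh|hk] := leqP k h; last by rewrite (card_lset_above BT) // (card_lset_above BC).
  case: (posnP k) => [->|k0]; first by rewrite (card_lset0 BT) (card_lset0 BC).
  have kh' : 0 < k <= h by rewrite k0.
  have [hk|hk] := ltnP (h - k) (h - ~~ e).
    rewrite (cat_card _ h0 qE kh' hk).
    have -> : l + 1 - (h - k).+1 = k + e by rewrite lE; case: (e) => /=; lia.
    rewrite mE; last by rewrite lE; case: (e) hk => /=; lia.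
    have -> : ~~ e + (k + e).-1 = k by case: (e) => /=; lia.
    (* The truncated subtraction in [t] loses nothing: the level has at least two vertices. *)
    by have := card_lset_gt1 BT kh'; lia.
  (* What remains is level 1 for odd diameter, which consists of the two centres in both trees. *)
  have e0 : ~~ e by apply/negP => e1; move: hk; rewrite e1 /=; lia.
  have -> : k = 1 by move: hk; rewrite e0 /=; lia.
  by rewrite (card_lset1_odd BT e0) (card_lset1_odd BC e0).
split; last first.
  do 7!eexists; exists (cat_be e h (b l - 1) (fun j => m (l + 1 - j) - 2)).
  by split; [exact: BC|exact: SC|exact: cardL].
split; first exact: rooted_is_tree (br_rooted BC).
rewrite -seqT; apply: ecc_seq_eq => v.
have [hv|hv] := leqP (h - ~~ e) v.
  by rewrite -(subnK hv) (card_ecc BT) (card_ecc BC).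
rewrite !eq_card0 // => z; rewrite !inE ?(branched_ecc BT) ?(branched_ecc BC).
  by apply/eqP; lia.
by apply/eqP; lia.
Qed.

Lemma ecc_caterpillar_extremal l b m (T : sgraph) :
  mult_form l b m -> 2 < \sum_(1 <= i < l.+1) m i ->
  tree_with (mult_seq l b m) T ->
  let C := ecc_caterpillar l b m in
  [/\ tree_with (mult_seq l b m) C,
      wiener C <= wiener T /\ (wiener T = wiener C -> isomorphic T C) &
      num_subtrees T <= num_subtrees C /\
      (num_subtrees T = num_subtrees C -> isomorphic T C)].
Proof.
move=> mf n2 [tT seqT] C.
have nT : 1 < #|T| by rewrite -size_ecc_seq seqT size_mult_seq ltnW.
have [c [par [dp [e [h [r [x [y BT]]]]]]]] := tree_branched tT nT.
have [tC] := ecc_caterpillar_branched mf BT seqT.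
case=> c' [par' [dp' [r' [x' [y' [al [be [BC SC cardL]]]]]]]]; split=> //.
all: have cardE : #|T| = #|C| by case: tC => _ seqC; rewrite -!size_ecc_seq seqT seqC.
all: have tC' := spine_tight BC SC.
all: have iso : rigid c par dp e h r x y -> isomorphic T C by
  move=> /(rigid_spine BT)[al0 [be0 S0]]; apply: (spine_isomorphic S0 SC cardL).
- have [? rig] := branched_wiener_le BT BC tC' cardE (fun k _ => cardL k).
  by split=> // /rig.
- have [? rig] := branched_num_subtrees_le BT BC tC' cardE (fun k _ => cardL k).
  by split=> // /rig.
Qed.

Theorem mainTheorem1 (l : nat) (b m : nat -> nat)
    (hS : mult_form l b m)
    (htree : exists T : sgraph, tree_with (mult_seq l b m) T)
    (hsum : 2 < \sum_(1 <= i < l.+1) m i) :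
  (minimises wiener (tree_with (mult_seq l b m)) (ecc_caterpillar l b m) /\
   forall T : sgraph, minimises wiener (tree_with (mult_seq l b m)) T ->
     isomorphic T (ecc_caterpillar l b m)) /\
  (maximises num_subtrees (tree_with (mult_seq l b m)) (ecc_caterpillar l b m) /\
   forall T : sgraph, maximises num_subtrees (tree_with (mult_seq l b m)) T ->
     isomorphic T (ecc_caterpillar l b m)).
Proof.
have [T0 tT0] := htree; have [tC _ _] := ecc_caterpillar_extremal hS hsum tT0.
split; split.
- by split=> // T /(ecc_caterpillar_extremal hS hsum)[_ []].
- move=> T [tT minT]; have [_ [le iso] _] := ecc_caterpillar_extremal hS hsum tT.
  by apply: iso; apply/eqP; rewrite eqn_leq le minT.
- by split=> // T /(ecc_caterpillar_extremal hS hsum)[_ _ []].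
- move=> T [tT maxT]; have [_ _ [le iso]] := ecc_caterpillar_extremal hS hsum tT.
  by apply: iso; apply/eqP; rewrite eqn_leq le maxT.
Qed.
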